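(* Let $\mathcal G$ be a finite groupoid and let $\Lambda\mathcal G$ be its loop groupoid. Then the Parmesan map $\mathrm{Par}\colon \mathcal B\Lambda\mathcal G\to \mathcal L\mathcal B\mathcal G$ is a homotopy equivalence.
   Context: A finite groupoid is a category with finitely many objects and morphisms in which every morphism is invertible. Composition $g_2\circ g_1$ (also written $g_2g_1$) means first $g_1$, then $g_2$. Classifying space. For a groupoid $\mathcal G$, the space $\mathcal B\mathcal G$ has one $n$-simplex for each string of $n$ composable morphisms $x_n\xleftarrow{g_n}\cdots\xleftarrow{g_2}x_1\xleftarrow{g_1}x_0$ (a $0$-simplex is an object), parametrized by coordinates $0\le t_n\le\dots\le t_1\le 1$; the corresponding point is written $[g_n,t_n|\ldots|g_1,t_1]$. Simplices are glued along faces by the identifications $[g_n,t_n|\ldots|g_2,t_2|g_1,1]=[g_n,t_n|\ldots|g_2,t_2]$; $[g_n,t_n|\ldots|g_{i+1},t|g_i,t|\ldots|g_1,t_1]=[g_n,t_n|\ldots|g_{i+1}\circ g_i,t|\ldots|g_1,t_1]$; $[g_n,0|g_{n-1},t_{n-1}|\ldots|g_1,t_1]=[g_{n-1},t_{n-1}|\ldots|g_1,t_1]$. No degeneracy identifications are made (simplices containing identity morphisms are not collapsed). Loop groupoid. $\Lambda\mathcal G$ has as objects all self-morphisms $\gamma\in\coprod_{x}\mathrm{Mor}_{\mathcal G}(x,x)$, and a morphism $g\colon\gamma\to g\gamma g^{-1}$ for each $\gamma\in\mathrm{Mor}_{\mathcal G}(x,x)$ and $g\in\mathrm{Mor}_{\mathcal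 G}(x,y)$; composition is induced from $\mathcal G$. The simplex $g_n\cdots g_1\gamma g_1^{-1}\cdots g_n^{-1}\xleftarrow{g_n}\cdots\xleftarrow{g_1}\gamma$ of $\mathcal B\Lambda\mathcal G$ is written $[g_n|\ldots|g_1]\gamma$, and the point of it with coordinates $t_i$ is written $[g_n,t_n|\ldots|g_1,t_1]\gamma$. Free loop space. $\mathcal L\mathcal B\mathcal G:=\mathrm{Maps}(S^1,\mathcal B\mathcal G)$ with $S^1=[0,1]/(0\sim1)$. Parmesan map. $\mathrm{Par}\colon\mathcal B\Lambda\mathcal G\to\mathcal L\mathcal B\mathcal G$ is defined by $$\mathrm{Par}([g_n,t_n|\ldots|g_1,t_1]\gamma)(t)=[g_n,t_n|\ldots|g_{i+1},t_{i+1}\,|\,(g_i\cdots g_1)\gamma(g_i\cdots g_1)^{-1},t\,|\,g_i,t_i|\ldots|g_1,t_1]\quad\text{for } t_i\ge t\ge t_{i+1},$$ for $0\le i\le n$, with the conventions $t_0=1$, $t_{n+1}=0$. *)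

(* Defs.v *)
From HB Require Import structures.
From mathcomp Require Import all_boot all_order all_algebra.
From mathcomp Require Import generic_quotient.
From mathcomp Require Import all_classical all_reals all_analysis.
From mathcomp Require Import zify.
From Stdlib Require Import Relation_Operators.

Set Implicit Arguments.
Unset Strict Implicit.
Unset Printing Implicit Defensive.

Import Order.TTheory GRing.Theory Num.Theory.
Import numFieldNormedType.Exports.

Local Open Scope classical_set_scope.
Local Open Scope ring_scope.
Local Open Scope quotient_scope.

(* [compg h g] is "first [g], then [h]". *)
Record finGroupoid := FinGroupoid {
  ob :> finType;
  hom : ob -> ob -> finType;
  idg : forall x, hom x x;
  compg : forall x y z, hom y z -> hom x y -> hom x z;
  invg : forall x y, hom x y -> hom y x;
  compgA : forall x y z t (h : hom z t) (g : hom y z) (f : hom x y),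
    compg h (compg g f) = compg (compg h g) f;
  comp1g : forall x y (f : hom x y), compg (idg y) f = f;
  compg1 : forall x y (f : hom x y), compg f (idg x) = f;
  compVg : forall x y (f : hom x y), compg (invg f) f = idg x;
  compgV : forall x y (f : hom x y), compg f (invg f) = idg y
}.

Notation "g \og f" := (compg g f) (at level 40, left associativity).

Section LoopGroupoid.
Variable G : finGroupoid.

Definition loop_ob : finType := {x : G & hom x x}.

Definition conjg (x y : G) (g : hom x y) (c : hom x x) : hom y y :=
  g \og c \og invg g.

Lemma conjg_comp (x y z : G) (h : hom y z) (g : hom x y) (c : hom x x) :
  conjg (h \og g) c = conjg h (conjg g c).
Proof.
rewrite /conjg; suff -> : invg (h \og g) = invg g \og invg h by rewrite !compgA.
rewrite -[LHS]compg1 -(compgV h) -{2}(compg1 h) -(compgV g) !compgA.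
by rewrite -(compgA _ h g) compVg comp1g.
Qed.

Definition loop_hom (a b : loop_ob) : finType :=
  {g : hom (tag a) (tag b) | conjg g (tagged a) == tagged b}.

Lemma loop_id_subproof (a : loop_ob) :
  conjg (idg (tag a)) (tagged a) == tagged a.
Proof.
rewrite /conjg comp1g -[X in _ == X]compg1; apply/eqP; congr (_ \og _).
by rewrite -[LHS]comp1g compgV.
Qed.

Lemma loop_comp_subproof (a b c : loop_ob) (h : loop_hom b c)
    (g : loop_hom a b) :
  conjg (val h \og val g) (tagged a) == tagged c.
Proof.
case: h g => h /= /eqP <- [g /= /eqP <-]; apply/eqP; exact: conjg_comp.
Qed.

Lemma loop_inv_subproof (a b : loop_ob) (g : loop_hom a b) :
  conjg (invg (val g)) (tagged b) == tagged a.
Proof.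
case: g => g /= /eqP <-; apply/eqP; rewrite /conjg !compgA compVg comp1g.
rewrite -compgA -[RHS]compg1; congr (_ \og _).
by rewrite compgV.
Qed.

Definition loop_id (a : loop_ob) : loop_hom a a :=
  Sub (idg (tag a)) (loop_id_subproof a).

Definition loop_comp (a b c : loop_ob) (h : loop_hom b c) (g : loop_hom a b) :
  loop_hom a c := Sub (val h \og val g) (loop_comp_subproof h g).

Definition loop_inv (a b : loop_ob) (g : loop_hom a b) : loop_hom b a :=
  Sub (invg (val g)) (loop_inv_subproof g).

Lemma loop_compA (a b c d : loop_ob) (h : loop_hom c d) (g : loop_hom b c)
    (f : loop_hom a b) :
  loop_comp h (loop_comp g f) = loop_comp (loop_comp h g) f.
Proof. exact/val_inj/compgA. Qed.

Lemma loop_comp1l (a b : loop_ob) (f : loop_hom a b) :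
  loop_comp (loop_id b) f = f.
Proof. exact/val_inj/comp1g. Qed.

Lemma loop_comp1r (a b : loop_ob) (f : loop_hom a b) :
  loop_comp f (loop_id a) = f.
Proof. exact/val_inj/compg1. Qed.

Lemma loop_compVl (a b : loop_ob) (f : loop_hom a b) :
  loop_comp (loop_inv f) f = loop_id a.
Proof. exact/val_inj/compVg. Qed.

Lemma loop_compVr (a b : loop_ob) (f : loop_hom a b) :
  loop_comp f (loop_inv f) = loop_id b.
Proof. exact/val_inj/compgV. Qed.

Definition loop_groupoid : finGroupoid :=
  FinGroupoid loop_compA loop_comp1l loop_comp1r loop_compVl loop_compVr.

End LoopGroupoid.

(* Strings of [n] composable morphisms starting at [x], source side first:
   x_n <-g_n- ... <-g_1- x_0 is encoded as (x_1; (g_1, (x_2; (g_2, ...)))). *)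
Fixpoint string (G : finGroupoid) (n : nat) (x : G) : finType :=
  match n with
  | 0 => unit
  | m.+1 => {y : ob G & (hom x y * @string G m y)%type}
  end.

Definition nsimplex (G : finGroupoid) (n : nat) : finType :=
  {x : ob G & string n x}.

(* [inner_face i] replaces g_(i+1), g_(i+2) by their composite; for [i = n] it
   drops the last morphism instead. *)
Fixpoint inner_face (G : finGroupoid) (n i : nat) :
    forall x : G, string n.+1 x -> string n x :=
  match n return forall x : G, string n.+1 x -> string n x with
  | 0 => fun _ _ => tt
  | m.+1 => fun x s =>
    match i with
    | 0 => let: existT y (g, existT z (h, c)) := s in existT _ z (h \og g, c)
    | j.+1 => let: existT y (g, c) := s in existT _ y (g, inner_face j c)
    end
  end.

(* The [i]-th face, [0 <= i <= n.+1]: drops g_1 if [i = 0], replaces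
   g_i, g_(i+1) by g_(i+1) g_i if [0 < i < n.+1], drops g_(n+1) if
   [i = n.+1]. *)
Definition face (G : finGroupoid) (n i : nat) (s : nsimplex G n.+1) :
    nsimplex G n :=
  match i with
  | 0 => let: existT x (existT y (g, c)) := s in existT _ y c
  | j.+1 => let: existT x c := s in existT _ x (inner_face j c)
  end.

Section Simplex.
Variable R : realType.

(* The coordinate t_k, with the conventions t_0 = 1 and t_(n+1) = 0. *)
Definition scoord (n : nat) (t : 'rV[R]_n) (k : nat) : R :=
  if k is j.+1 then (if insub j is Some i then t 0 i else 0) else 1.

Definition std_simplex (n : nat) : set 'rV[R]_n :=
  [set t | forall k, (k <= n)%N -> scoord t k.+1 <= scoord t k].
Arguments std_simplex : clear implicits.

(* The coordinates (t_1, ..., t_i, t_i, ..., t_n); for [i = 0] this is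
   (1, t_1, ..., t_n) and for [i = n.+1] it is (t_1, ..., t_n, 0). *)
Definition coface (n i : nat) (t : 'rV[R]_n) : 'rV[R]_n.+1 :=
  \row_(j < n.+1) scoord t (if (j < i)%N then j.+1 else j).

(* (t_1, ..., t_m, u, t_(m+1), ..., t_n) *)
Definition insert_coord (n m : nat) (u : R) (t : 'rV[R]_n) : 'rV[R]_n.+1 :=
  \row_(j < n.+1)
    if (j < m)%N then scoord t j.+1
    else if j == m :> nat then u else scoord t j.

Arguments scoord : simpl never.

Lemma scoordS n (t : 'rV[R]_n) (i : 'I_n) : scoord t i.+1 = t 0 i.
Proof. by rewrite /scoord insubT //= => Hi; congr (t 0 _); apply: val_inj. Qed.

Lemma scoord_out n (t : 'rV[R]_n) k : (n < k)%N -> scoord t k = 0.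
Proof. by case: k => // k Hk; rewrite /scoord insubN // -leqNgt. Qed.

Lemma scoord_row n (f : nat -> R) k : (k < n)%N ->
  scoord (\row_(j < n) f j) k.+1 = f k.
Proof. by move=> Hk; rewrite -[k]/(nat_of_ord (Ordinal Hk)) scoordS mxE. Qed.

Lemma scoordP n (t u : 'rV[R]_n) : scoord t =1 scoord u -> t = u.
Proof. by move=> tu; apply/rowP => i; rewrite -!scoordS tu. Qed.

Lemma scoord_cofaceE n i (t : 'rV[R]_n) k : (i <= n.+1)%N ->
  scoord (coface i t) k = scoord t (if (k <= i)%N then k else k.-1).
Proof.
move=> le_i; case: k => [//|k].
have [lt_k|ge_k] := ltnP k n.+1; last first.
  rewrite scoord_out ?ltnS // scoord_out //.
  by case: ifP => //= k_i; have := leq_trans k_i le_i; rewrite ltnNge ge_k.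
rewrite (scoord_row (fun j => scoord t (if (j < i)%N then j.+1 else j))) //.
Qed.

Lemma scoord_insertE n m u (t : 'rV[R]_n) k : (m <= n)%N ->
  scoord (insert_coord m u t) k =
  if (k <= m)%N then scoord t k else if k == m.+1 then u else scoord t k.-1.
Proof.
move=> le_m; case: k => [//|k].
have [lt_k|ge_k] := ltnP k n.+1; last first.
  have lt_mk : (m < k)%N by exact: leq_ltn_trans ge_k.
  by rewrite scoord_out ?ltnS // ltnNge ltnW //= eqSS gtn_eqF // scoord_out.
by rewrite (scoord_row (fun j => if (j < m)%N then scoord t j.+1
     else if j == m then u else scoord t j)).
Qed.

Lemma scoord_le n (t : 'rV[R]_n) : std_simplex n t ->
  {homo scoord t : k l / (k <= l)%N >-> l <= k}.
Proof.
move=> ht k l; elim: l => [|l IHl]; first by rewrite leqn0 => /eqP ->.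
rewrite leq_eqVlt ltnS => /predU1P[-> //|/IHl]; apply: le_trans.
have [/ht //|lt_n] := leqP l n.
by rewrite !scoord_out // ltnW.
Qed.

Lemma coface_simplex n i (t : 'rV[R]_n) : (i <= n.+1)%N ->
  std_simplex n t -> std_simplex n.+1 (coface i t).
Proof.
move=> le_i ht k _; rewrite !scoord_cofaceE //; apply: scoord_le => //.
by case: ltngtP => // _; exact: leq_pred.
Qed.

Lemma insert_coord_simplex n m u (t : 'rV[R]_n) : (m <= n)%N ->
  scoord t m.+1 <= u <= scoord t m ->
  std_simplex n t -> std_simplex n.+1 (insert_coord m u t).
Proof.
move=> le_m /andP[lu ul] ht k _; rewrite !scoord_insertE //= eqSS.
have [lt_km|lt_mk|->] := ltngtP k m.
- exact: scoord_le.
- by case: eqP => [-> //|_]; apply: scoord_le => //; exact: leq_pred.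
- by [].
Qed.

End Simplex.
Arguments scoord R n t k : simpl never.
Arguments std_simplex R n : clear implicits.

Section ClassifyingSpace.
Variables (R : realType) (G : finGroupoid).

(* The disjoint union, over all simplices [s] of the nerve, of copies of the
   standard simplex of the dimension of [s]. *)
Definition points : topologicalType :=
  {s : {n : nat & nsimplex G n} & set_type (std_simplex R (tag s))}.

Definition point_of (n : nat) (s : nsimplex G n) (t : 'rV[R]_n)
    (ht : std_simplex R n t) : points :=
  existT (fun s => set_type (std_simplex R (tag s)))
    (existT _ n s) (exist _ t (mem_set ht)).

(* With coordinates written from t_n down to t_1, the three kinds of
   identifications are
     [g_(n+1), t_n | ... | g_2, t_1 | g_1, 1] = [g_(n+1), t_n | ... | g_2, t_1],
     [... | g_(i+1), t_i | g_i, t_i | ...] = [... | g_(i+1) g_i, t_i | ...],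
     [g_(n+1), 0 | g_n, t_n | ... | g_1, t_1] = [g_n, t_n | ... | g_1, t_1],
   for [i = 0], [0 < i < n.+1] and [i = n.+1] respectively. *)
Inductive glue : points -> points -> Prop :=
  Glue (n i : nat) (s : nsimplex G n.+1) (t : 'rV[R]_n) (le_i : (i <= n.+1)%N)
      (ht : std_simplex R n t) :
    glue (point_of s (coface_simplex le_i ht)) (point_of (face i s) ht).

Definition glued (p q : points) : bool := `[< clos_refl_sym_trans _ glue p q >].

Lemma glued_refl : reflexive glued.
Proof. by move=> p; apply/asboolP; exact: rst_refl. Qed.

Lemma glued_sym : symmetric glued.
Proof. by move=> p q; apply/asboolP/asboolP; exact: rst_sym. Qed.

Lemma glued_trans : transitive glued.
Proof.
by move=> q p r /asboolP pq /asboolP qr; apply/asboolP; exact: rst_trans qr.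
Qed.

Definition glued_equiv : equiv_rel points :=
  EquivRel glued glued_refl glued_sym glued_trans.

Definition classifying_space := {eq_quot glued_equiv}.

HB.instance Definition _ :=
  Topological.copy classifying_space (quotient_topology classifying_space).
HB.instance Definition _ := Quotient.on classifying_space.

Lemma point_ofE n (s s' : nsimplex G n) t t' (ht : std_simplex R n t)
    (ht' : std_simplex R n t') :
  s = s' -> t = t' -> point_of s ht = point_of s' ht'.
Proof.
move=> -> tt'; case: _ / tt' in ht' *.
by congr point_of; exact: Prop_irrelevance.
Qed.

Lemma pi_glue n i (s : nsimplex G n.+1) (s' : nsimplex G n) t u
    (ht : std_simplex R n t) (hu : std_simplex R n.+1 u) :
  (i <= n.+1)%N -> u = coface i t -> s' = face i s ->
  \pi_classifying_space (point_of s hu) =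
  \pi_classifying_space (point_of s' ht).
Proof.
move=> le_i uE ->; apply/eqmodP; apply/asboolP; apply: rst_step.
by rewrite (point_ofE hu (coface_simplex le_i ht) erefl uE); exact: Glue.
Qed.

End ClassifyingSpace.

Section FreeLoopSpace.
Variable R : realType.

Definition unit_interval : topologicalType :=
  set_type (`[0, 1]%classic : set R).

Lemma in_unit_interval (u : R) : 0 <= u <= 1 -> u \in (`[0, 1]%classic : set R).
Proof. by move=> hu; apply/mem_set; rewrite /= in_itv. Qed.

Lemma unit_intervalP (u : unit_interval) : 0 <= \val u <= 1.
Proof. by have := set_mem (valP u); rewrite /= in_itv. Qed.

Definition unit0 : unit_interval :=
  exist _ 0 (in_unit_interval (introT andP (conj (lexx 0) ler01))).
Definition unit1 : unit_interval :=
  exist _ 1 (in_unit_interval (introT andP (conj ler01 (lexx 1)))).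

Definition is_end (a : unit_interval) : bool := (a == unit0) || (a == unit1).

Definition circle_rel (a b : unit_interval) : bool :=
  (a == b) || (is_end a && is_end b).

Lemma circle_rel_refl : reflexive circle_rel.
Proof. by move=> a; rewrite /circle_rel eqxx. Qed.

Lemma circle_rel_sym : symmetric circle_rel.
Proof. by move=> a b; rewrite /circle_rel eq_sym andbC. Qed.

Lemma circle_rel_trans : transitive circle_rel.
Proof.
move=> b a c /predU1P[-> //|/andP[ea eb]] /predU1P[<-|/andP[_ ec]].
  by rewrite /circle_rel ea eb orbT.
by rewrite /circle_rel ea ec orbT.
Qed.

Definition circle_equiv : equiv_rel unit_interval :=
  EquivRel circle_rel circle_rel_refl circle_rel_sym circle_rel_trans.

Definition circle := {eq_quot circle_equiv}.

HB.instance Definition _ := Topological.copy circle (quotient_topology circle).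
HB.instance Definition _ := Quotient.on circle.

Definition free_loop_space (X : topologicalType) : Type :=
  continuousType circle X.

HB.instance Definition _ (X : topologicalType) :=
  Topological.copy (free_loop_space X)
    (initial_topology
      (fun l : continuousType circle X => l : {compact-open, circle -> X})).

Section Homotopy.
Variables X Y : topologicalType.

Definition homotopic (f g : X -> Y) : Prop :=
  exists H : X * unit_interval -> Y,
    [/\ continuous H, forall x, H (x, unit0) = f x
      & forall x, H (x, unit1) = g x].

End Homotopy.

Definition homotopy_equivalence (X Y : topologicalType) (f : X -> Y) : Prop :=
  continuous f /\
  exists g : Y -> X,
    [/\ continuous g, homotopic (g \o f) id & homotopic (f \o g) id].

End FreeLoopSpace.
Arguments homotopy_equivalence R {X Y} f.

Section Parmesan.
Variables (R : realType) (G : finGroupoid).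

Local Notation L := (loop_groupoid G).
Local Notation BG := (classifying_space R G).
Local Notation BL := (classifying_space R L).

Fixpoint forget (n : nat) : forall a : L, string n a -> string n (tag a) :=
  match n return forall a : L, string n a -> string n (tag a) with
  | 0 => fun _ _ => tt
  | _.+1 => fun a s =>
    let: existT b (g, c) := s in existT _ (tag b) (val g, forget c)
  end.

(* [insert_loop m c] inserts the loop (g_m ... g_1) c (g_m ... g_1)^-1 after
   g_1, ..., g_m; only [m <= n] is meaningful. *)
Fixpoint insert_loop (n m : nat) :
    forall x : G, hom x x -> string n x -> string n.+1 x :=
  match n return forall x : G, hom x x -> string n x -> string n.+1 x with
  | 0 => fun x c _ => existT _ x (c, tt)
  | _.+1 => fun x c s =>
    match m with
    | 0 => existT _ x (c, s)
    | k.+1 =>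
      let: existT y (g, s') := s in
      existT _ y (g, insert_loop k (conjg g c) s')
    end
  end.

Definition par_simplex (n m : nat) (s : nsimplex L n) : nsimplex G n.+1 :=
  let: existT a s' := s in
  existT _ (tag a) (insert_loop m (tagged a) (forget s')).

Lemma insert_loop0 n (x : G) (c : hom x x) (s : string n x) :
  insert_loop 0 c s = existT _ x (c, s).
Proof. by case: n s => [[]|n s]. Qed.

Lemma insert_loopS n m (x y : G) (c : hom x x) (g : hom x y) (s : string n y) :
  insert_loop m.+1 c (existT _ y (g, s) : string n.+1 x) =
  existT _ y (g, insert_loop m (conjg g c) s).
Proof. by []. Qed.

Lemma inner_faceS n j (x y : G) (g : hom x y) (s : string n.+1 y) :
  inner_face j.+1 (existT _ y (g, s) : string n.+2 x) =
  existT _ y (g, inner_face j s).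
Proof. by []. Qed.

Lemma inner_face_forget n j (a : L) (s : string n.+1 a) :
  inner_face j (forget s) = forget (inner_face j s).
Proof.
elim: n j a s => [|n IHn] [|j] a [b [g s]] //.
  by case: s => d [h s].
by rewrite /= -IHn.
Qed.

Lemma inner_face_insert_loop n m (x : G) (c : hom x x) (s : string n x) :
  (m < n)%N ->
  inner_face m (insert_loop m c s) = inner_face m (insert_loop m.+1 c s).
Proof.
elim: n m x c s => [//|n IHn] [|m] x c [y [g s]] lt_m.
  rewrite insert_loopS !insert_loop0 /=.
  suff -> : g \og c = conjg g c \og g by [].
  by rewrite /conjg -compgA compVg compg1.
by rewrite !insert_loopS /= IHn.
Qed.

Lemma inner_face_last n (x : G) (c : hom x x) (s : string n x) :
  inner_face n (insert_loop n c s) = s.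
Proof.
elim: n x c s => [|n IHn] x c; first by case.
by case=> y [g s]; rewrite insert_loopS /= IHn.
Qed.

Lemma inner_face_insert_le n m j (x : G) (c : hom x x) (s : string n.+1 x) :
  (m <= j)%N -> (m <= n)%N ->
  inner_face j.+1 (insert_loop m c s) = insert_loop m c (inner_face j s).
Proof.
elim: n m j x c s => [|n IHn] [|m] j x c s // le_mj le_mn.
case: j le_mj => // j le_mj; case: s => y [g s].
by rewrite insert_loopS inner_faceS IHn.
Qed.

Lemma inner_face_insert_gt n m j (x : G) (c : hom x x) (s : string n.+1 x) :
  (j < m)%N -> (m <= n)%N ->
  inner_face j (insert_loop m.+1 c s) = insert_loop m c (inner_face j s).
Proof.
elim: n m j x c s => [|n IHn] [|m] [|j] x c [y [g s]] // lt_jm le_mn.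
- by case: s => z [h s]; rewrite /= conjg_comp.
- by rewrite insert_loopS inner_faceS IHn.
Qed.

Lemma face_par_simplex n m i (s : nsimplex L n.+1) : (m <= n)%N ->
  face (if (m < i)%N then i.+1 else i)
    (par_simplex (if (m < i)%N then m else m.+1) s) =
  par_simplex m (face i s).
Proof.
move=> le_mn; case: s => a s; case: i => [|j] /=.
  by case: s => b [[g /= /eqP gE] s]; rewrite /= gE.
rewrite -inner_face_forget ltnS; case: leqP => [le_mj|lt_jm].
  by congr existT; exact: inner_face_insert_le.
by congr existT; exact: inner_face_insert_gt.
Qed.

Lemma insert_coord_coface n m i u (t : 'rV[R]_n) :
  (i <= n.+1)%N -> (m <= n)%N ->
  insert_coord (if (m < i)%N then m else m.+1) u (coface i t) =
  coface (if (m < i)%N then i.+1 else i) (insert_coord m u t).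
Proof.
move=> le_i le_m; apply: scoordP => k.
have le_i' : ((if (m < i)%N then i.+1 else i) <= n.+2)%N.
  by case: ifP => _ //; exact: leqW.
have le_m' : ((if (m < i)%N then m else m.+1) <= n.+1)%N.
  by case: ifP => _ //; exact: leqW.
rewrite [RHS]scoord_cofaceE // !scoord_insertE // !scoord_cofaceE //.
case: (ltnP m i) => mi /=; [case: (leqP k i.+1) | case: (leqP k i)] => ki;
  do ![case: ifP => ?]; do ?[lia | done | congr (scoord t _); lia].
Qed.


Lemma par_index_subproof n (t : 'rV[R]_n) (u : R) : 0 <= u <= 1 ->
  exists m : 'I_n.+1, scoord t m.+1 <= u <= scoord t m.
Proof.
move=> /andP[u0 u1].
have tn : scoord t n.+1 <= u by rewrite scoord_out.
case: (@ex_minnP (fun m => scoord t m.+1 <= u)); first by exists n.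
move=> m tm min_m; have lt_m : (m < n.+1)%N by rewrite ltnS min_m.
exists (Ordinal lt_m); rewrite tm /=.
case: m => [//|m] in tm min_m lt_m *.
by rewrite leNgt; apply/negP => /ltW /min_m; rewrite ltnn.
Qed.

(* The index of a segment [t_(m+1), t_m] containing [u]; by [par_valE] below
   the choice is immaterial. *)
Definition par_index n (t : 'rV[R]_n) (u : R) (hu : 0 <= u <= 1) : 'I_n.+1 :=
  xchoose (par_index_subproof t hu).

Definition par_val n (s : nsimplex L n) (t : 'rV[R]_n)
    (ht : std_simplex R n t) (u : R) (hu : 0 <= u <= 1) : BG :=
  let m := par_index t hu in
  \pi_BG (point_of (par_simplex m s)
    (insert_coord_simplex (leq_ord m)
       (xchooseP (par_index_subproof t hu)) ht)).

Lemma par_step n m (s : nsimplex L n) (t : 'rV[R]_n) u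
    (h1 : std_simplex R n.+1 (insert_coord m u t))
    (h2 : std_simplex R n.+1 (insert_coord m.+1 u t)) :
  (m < n)%N -> u = scoord t m.+1 -> std_simplex R n t ->
  \pi_BG (point_of (par_simplex m s) h1) =
  \pi_BG (point_of (par_simplex m.+1 s) h2).
Proof.
move=> lt_m uE ht; have le_m : (m.+1 <= n.+1)%N by exact: ltnW.
case: s => a c; rewrite [LHS](pi_glue (i := m.+1)
  (s' := face m.+1 (par_simplex m (existT _ a c))) ht) //; last first.
  apply: scoordP => k; rewrite scoord_cofaceE // scoord_insertE ?(ltnW lt_m) //.
  by rewrite uE; do ![case: ifP => ?]; congr (scoord t _); lia.
rewrite [RHS](pi_glue (i := m.+1)
  (s' := face m.+1 (par_simplex m (existT _ a c))) ht) //=.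
  apply: scoordP => k; rewrite scoord_cofaceE // scoord_insertE //.
  by rewrite uE; do ![case: ifP => ?]; congr (scoord t _); lia.
by rewrite inner_face_insert_loop.
Qed.

Lemma par_val_indep n (s : nsimplex L n) (t : 'rV[R]_n) u m m'
    (h1 : std_simplex R n.+1 (insert_coord m u t))
    (h2 : std_simplex R n.+1 (insert_coord m' u t)) :
  std_simplex R n t -> (m <= n)%N -> (m' <= n)%N ->
  scoord t m.+1 <= u <= scoord t m -> scoord t m'.+1 <= u <= scoord t m' ->
  \pi_BG (point_of (par_simplex m s) h1) =
  \pi_BG (point_of (par_simplex m' s) h2).
Proof.
move=> ht; wlog le_mm' : m m' h1 h2 / (m <= m')%N.
  move=> H; have [|/ltnW] := leqP m m'; first exact: H.
  by move=> le_m'm le_m le_m' hm hm'; symmetry; exact: H.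
move=> le_m le_m' /andP[lu ul] /andP[lu' ul'].
elim: m' le_mm' h2 le_m' lu' ul' => [|m' IHm].
  by rewrite leqn0 => /eqP m0; subst m => *; congr \pi_BG; exact: point_ofE.
rewrite leq_eqVlt => /predU1P[mE|];
  last rewrite ltnS => le_mm' h2 lt_m' lu' ul'.
  by subst m => *; congr \pi_BG; exact: point_ofE.
have tE : u = scoord t m'.+1.
  apply/le_anti; rewrite ul' /=; apply: le_trans lu.
  exact: (scoord_le ht).
have hm' : std_simplex R n.+1 (insert_coord m' u t).
  by apply: insert_coord_simplex; rewrite ?(ltnW lt_m') // tE lexx scoord_le.
rewrite -(par_step s hm') // (IHm _ hm') //; first exact: ltnW.
  by rewrite tE.
by rewrite tE scoord_le.
Qed.

Lemma par_valE n (s : nsimplex L n) (t : 'rV[R]_n) (ht : std_simplex R n t)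
    (u : R) (hu : 0 <= u <= 1) m (le_m : (m <= n)%N)
    (hm : scoord t m.+1 <= u <= scoord t m) :
  par_val s ht hu =
  \pi_BG (point_of (par_simplex m s) (insert_coord_simplex le_m hm ht)).
Proof.
apply: par_val_indep => //; first by rewrite -ltnS.
exact: (xchooseP (par_index_subproof t hu)).
Qed.

Lemma par_val_coface n i (s : nsimplex L n.+1) (t : 'rV[R]_n)
    (le_i : (i <= n.+1)%N) (ht : std_simplex R n t) (u : R) (hu : 0 <= u <= 1) :
  par_val s (coface_simplex le_i ht) hu = par_val (face i s) ht hu.
Proof.
have [[m /= lt_m] hm] := par_index_subproof t hu.
have le_m : (m <= n)%N by [].
rewrite (par_valE _ _ _ le_m hm).
set m' := if (m < i)%N then m else m.+1.
have le_m' : (m' <= n.+1)%N by rewrite /m'; case: ifP => _; [exact: leqW|].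
have hm' : scoord (coface i t) m'.+1 <= u <= scoord (coface i t) m'.
  rewrite /m' !scoord_cofaceE //; case: (ltnP m i) => mi.
    by rewrite mi (ltnW mi).
  by rewrite !ifF //; lia.
rewrite (par_valE _ _ _ le_m' hm').
apply: (pi_glue (i := if (m < i)%N then i.+1 else i)).
- by case: ifP => _ //; exact: leqW.
- exact: insert_coord_coface.
- by rewrite face_par_simplex.
Qed.

Definition par_point (p : points R L) (u : unit_interval R) : BG :=
  par_val (tagged (tag p)) (set_valP (tagged p)) (unit_intervalP u).

Lemma par_val_irr n (s : nsimplex L n) t (ht ht' : std_simplex R n t) u
    (hu hu' : 0 <= u <= 1) : par_val s ht hu = par_val s ht' hu'.
Proof. by rewrite (Prop_irrelevance ht ht') (Prop_irrelevance hu hu'). Qed.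

Lemma par_point_of n (s : nsimplex L n) t (ht : std_simplex R n t) u :
  par_point (point_of s ht) u = par_val s ht (unit_intervalP u).
Proof. exact: par_val_irr. Qed.

Lemma par_point_glued p q u : glued p q -> par_point p u = par_point q u.
Proof.
move=> /asboolP; elim=> {p q} [p q|//|p q _ -> //|p q r _ -> _ -> //].
by case=> n i s t le_i ht; rewrite !par_point_of par_val_coface.
Qed.

Definition par_fun (x : BL) (u : unit_interval R) : BG := par_point (repr x) u.

Lemma par_funE n (s : nsimplex L n) t (ht : std_simplex R n t) u :
  par_fun (\pi_BL (point_of s ht)) u = par_val s ht (unit_intervalP u).
Proof.
rewrite -par_point_of /par_fun; apply: par_point_glued.
suff : glued_equiv R L (repr (\pi_BL (point_of s ht))) (point_of s ht) by [].
by apply/eqmodP; rewrite reprK.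
Qed.

Lemma par_fun_ends (x : BL) : par_fun x (unit0 R) = par_fun x (unit1 R).
Proof.
rewrite -[x]reprK; case: (repr x) => [[n [a c]] [t ht0]].
have ht := set_mem ht0.
have -> : existT _ (existT _ n (existT _ a c)) (exist _ t ht0) =
  point_of (existT _ a c) ht :> points R L.
  by congr existT; exact: val_inj.
rewrite !par_funE.
have hn : scoord t n.+1 <= 0 <= scoord t n.
  rewrite scoord_out // lexx /=.
  by rewrite -(scoord_out t (ltnSn n)); exact: scoord_le.
have h0 : scoord t 1 <= 1 <= scoord t 0 by rewrite lexx andbT (ht 0%N).
rewrite (par_valE _ _ _ (leqnn n) hn) (par_valE _ _ _ (leq0n n) h0).
rewrite (pi_glue (i := n.+1)
  (s' := existT _ (tag a) (forget c) : nsimplex G n) ht) //.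
- apply/esym.
  rewrite (pi_glue (i := 0%N)
    (s' := existT _ (tag a) (forget c) : nsimplex G n) ht) //=.
  + apply: scoordP => k; rewrite scoord_cofaceE // scoord_insertE //.
    by case: k => [|[|k]].
  + by rewrite insert_loop0.
- apply: scoordP => k; rewrite scoord_cofaceE // scoord_insertE //.
  do ![case: ifP => ?]; rewrite //; do ?[lia | congr (scoord t _); lia].
  by rewrite scoord_out //; lia.
- by rewrite /= inner_face_last.
Qed.

Lemma insert_coord_continuous n m (t : 'rV[R]_n) :
  continuous (fun u : R => insert_coord m u t).
Proof.
move=> u A [P uP PA].
suff : \forall v \near u, forall i j, P i j (insert_coord m v t i j).
  by apply: filterS => v Pv; exact: PA.
have FF : Filter (nbhs u) by exact: nbhs_filter.
apply: (@filter_forall R _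
  (fun i => [set v | forall j, P i j (insert_coord m v t i j)])
  (nbhs u) FF) => i.
apply: (@filter_forall R _
  (fun j => [set v | P i j (insert_coord m v t i j)]) (nbhs u) FF) => j.
have := uP i j; rewrite !mxE => uPij.
suff : (fun v => insert_coord m v t i j) @ u --> insert_coord m u t i j.
  by apply; rewrite mxE.
under eq_fun do rewrite mxE.
by rewrite mxE; case: ifP => _; [|case: ifP => _];
  [exact: cvg_cst|exact: cvg_id|exact: cvg_cst].
Qed.

Definition clamp (a b u : R) : R := Num.max a (Num.min b u).

Lemma clampP (a b u : R) : a <= b -> a <= clamp a b u <= b.
Proof.
by move=> ab; rewrite /clamp le_max lexx ge_max ab ge_min lexx.
Qed.

Lemma clamp_id (a b u : R) : a <= u <= b -> clamp a b u = u.
Proof. by move=> /andP[au ub]; rewrite /clamp min_r // max_r. Qed.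

Lemma clamp_continuous (a b : R) : continuous (clamp a b).
Proof.
have cstC (c : R) : continuous (cst c : R -> R) by move=> ?; exact: cvg_cst.
have c1 : continuous (cst b \min (id : R -> R)).
  by apply: min_fun_continuous; [exact: cstC|move=> ?; exact: cvg_id].
exact: (max_fun_continuous (cstC a) c1).
Qed.

Definition par_piece n (s : nsimplex L n) t (ht : std_simplex R n t)
    (m : 'I_n.+1) (u : unit_interval R) : BG :=
  \pi_BG (point_of (par_simplex m s)
    (insert_coord_simplex (leq_ord m)
       (clampP (val u) (ht m (leq_ord m))) ht)).

Lemma par_piece_continuous n (s : nsimplex L n) t (ht : std_simplex R n t) m :
  continuous (par_piece s ht m).
Proof.
pose f (u : unit_interval R) : set_type (std_simplex R n.+1) :=
  exist (fun x => x \in std_simplex R n.+1) _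
    (mem_set (insert_coord_simplex (leq_ord m)
       (clampP (val u) (ht m (leq_ord m))) ht)).
have cf : continuous f.
  have cval : continuous (val : unit_interval R -> R).
    exact: initial_continuous.
  have cg : continuous ((fun u => insert_coord m u t) \o
      (clamp (scoord t m.+1) (scoord t m) \o (val : unit_interval R -> R))).
    move=> u; apply: continuous_comp; last exact: insert_coord_continuous.
    by apply: continuous_comp; [exact: cval|exact: clamp_continuous].
  apply: continuous_comp_initial. exact: cg.
have -> : par_piece s ht m = \pi_BG \o (existT
  (fun s0 : {n : nat & nsimplex G n} => set_type (std_simplex R (tag s0)))
  (existT _ n.+1 (par_simplex m s)) \o f) by [].
move=> u; apply: continuous_comp; last exact: pi_continuous.
apply: continuous_comp; first exact: cf.
exact: existT_continuous.
Qed.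

Lemma par_val_continuous n (s : nsimplex L n) t (ht : std_simplex R n t) :
  continuous (fun u : unit_interval R => par_val s ht (unit_intervalP u)).
Proof.
apply/continuous_closedP => C clC.
pose A (m : 'I_n.+1) : set (unit_interval R) :=
  val @^-1` [set u | scoord t m.+1 <= u <= scoord t m].
have clA m : closed (A m).
  apply: preimage_closed => [u _|]; first exact: initial_continuous.
  rewrite (_ : [set u | _] = `[scoord t m.+1, scoord t m]%classic).
    exact: itv_closed.
  by apply/seteqP; split => u /=; rewrite in_itv.
rewrite (_ : _ @^-1` C =
  \big[setU/set0]_(m <- enum 'I_n.+1) (A m `&` par_piece s ht m @^-1` C)).
  apply: closed_bigsetU => m _; apply: closedI => //.
  by apply: preimage_closed => // u _; exact: par_piece_continuous.
have pieceE (m : 'I_n.+1) u (hm : A m u) :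
    par_val s ht (unit_intervalP u) = par_piece s ht m u.
  rewrite (par_valE _ _ _ (leq_ord m) hm); congr \pi_BG.
  by apply: point_ofE; rewrite // clamp_id.
rewrite -bigcup_seq; apply/seteqP; split => u /=.
  have [m hm] := par_index_subproof t (unit_intervalP u) => Cu.
  by exists m; [rewrite /= mem_enum|split => //=; rewrite -pieceE].
by case=> m _ [Amu /=]; rewrite (pieceE _ _ Amu).
Qed.

Lemma par_fun_continuous (x : BL) : continuous (par_fun x).
Proof. exact: par_val_continuous. Qed.

Lemma par_fun_circle (x : BL) : {homo par_fun x : u v /
  \pi_(circle R) u == \pi_(circle R) v :> circle R >-> u == v}.
Proof.
move=> u v /eqP/eqmodP /predU1P[-> //|].
by rewrite /is_end => /andP[/orP[]/eqP-> /orP[]/eqP->];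
  rewrite ?par_fun_ends.
Qed.

Lemma par_loop_continuous (x : BL) :
  continuous (par_fun x \o repr : circle R -> BG).
Proof.
apply: repr_comp_continuous; first exact: par_fun_continuous.
exact: par_fun_circle.
Qed.

Definition Par (x : BL) : free_loop_space R BG :=
  mkcts (@par_loop_continuous x).

Lemma ParE n (s : nsimplex L n) (t : 'rV[R]_n) (ht : std_simplex R n t)
    (u : unit_interval R) m (le_m : (m <= n)%N)
    (hm : scoord t m.+1 <= val u <= scoord t m) :
  Par (\pi_BL (point_of s ht)) (\pi_(circle R) u) =
  \pi_BG (point_of (par_simplex m s) (insert_coord_simplex le_m hm ht)).
Proof.
rewrite -(par_valE _ _ (unit_intervalP u)) -par_funE.
by apply/eqP/par_fun_circle; rewrite reprK.
Qed.

End Parmesan.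

(* Main.v *)
(** A point of [BG] is a weighted word of arrows with common source [x], taken
    up to precomposition. So the space [E x] of weighted words in the arrows out
    of [x] covers components of [BG], and two points of [E x] and [E x'] have the
    same image exactly when they differ by an arrow [x' -> x]. A loop [l] in [BG]
    lifts to a path [f] in some [E x] with [f 1 = f 0 . c] for a unique
    automorphism [c] of [x], and [(f 0, c)] determines a point of the classifying
    space of the loop groupoid; it depends continuously on [l], because lifts
    exist in families. This is a left inverse of [Par]. In the other direction,
    the Parmesan loop of [(f 0, c)] lifts to a path from [f 0] to [f 0 . c] as
    well. Concatenating weighted words joins any two points of [E x] by a segment,
    equivariantly, so the two lifts are homotopic through paths whose projections
    are loops. Concatenation is jointly continuous because [E x] is a
    k_omega-space, being the union of its compact skeleta. *)

Require Import Defs.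
From mathcomp Require Import all_boot all_order all_algebra.
From mathcomp Require Import all_classical all_reals all_analysis.
From mathcomp Require Import zify ring lra.
From HB Require Import structures.

Set Implicit Arguments.
Unset Strict Implicit.
Unset Printing Implicit Defensive.

Import Order.TTheory GRing.Theory Num.Theory.
Import numFieldNormedType.Exports.
Import Defs.

Local Open Scope classical_set_scope.
Local Open Scope ring_scope.
Local Open Scope quotient_scope.

(** * Spaces exhausted by compact stages *)

(** An arrow is recovered from its effect on a single letter, so translations act freely on words. A
    word may however contain a letter together with its translates, so the mere presence of a letter
    does not select a sheet of the covering; the letter found at a given level [c] of the
    coordinates does, and the condition is open. Words have two descriptions. As lists of letters
    with nonzero weights they are independent of the simplex that represents a point, so
    concatenation and cutting are defined on lists. Their continuity is checked in the coordinates
    of simplices, which requires products of word spaces to carry the final topology for products of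
    simplices. The Parmesan path is piecewise, with an index depending on the point. On words the
    pieces merge: every letter is cut at level [u], and the lower parts, translated by the loop,
    follow the upper ones. Letters of weight 0 disappear, which leaves exactly the word with the
    loop inserted. *)

Lemma hausdorff_prod (X Y : topologicalType) :
  hausdorff_space X -> hausdorff_space Y -> hausdorff_space (X * Y)%type.
Proof.
move=> hX hY [x y] [x' y'] cl; congr pair.
  apply: hX => A B Ax Bx'.
  have /(cl _ _)/= : nbhs (x, y) (A `*` setT).
    by exists (A, setT) => //; split => //; exact: filterT.
  have nB : nbhs (x', y') (B `*` setT).
    by exists (B, setT) => //; split => //; exact: filterT.
  by move=> /(_ _ nB) [[a b] [[/= ? _] [/= ? _]]]; exists a.
apply: hY => A B Ay By'.
have nA : nbhs (x, y) (setT `*` A).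
  by exists (setT, A) => //; split => //; exact: filterT.
have nB : nbhs (x', y') (setT `*` B).
  by exists (setT, B) => //; split => //; exact: filterT.
by have [[a b] [[/= _ ?] [/= _ ?]]] := cl _ _ nA nB; exists b.
Qed.

Lemma hausdorff_sep (X : topologicalType) (x y : X) :
  hausdorff_space X -> x <> y ->
  exists U V : set X, [/\ nbhs x U, nbhs y V & U `&` V = set0].
Proof.
move=> hX xy; apply: contrapT => H; apply: xy; apply: hX => A B Ax By.
apply/set0P/eqP => AB; apply: H; by exists A, B.
Qed.

(** The filter is kept general because [tube] applies this twice: to the neighborhoods of a point,
    then to the neighborhoods of a compact set. *)
Lemma tube_filter (X : Type) (Y : topologicalType) (F : set_system X)
    (Q : set Y) (W : X -> Y -> Prop) : ProperFilter F -> compact Q ->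
  (forall y, Q y -> exists A B, [/\ F A, nbhs y B &
     forall a b, A a -> B b -> W a b]) ->
  exists A V, [/\ F A, open V, Q `<=` V & forall a b, A a -> V b -> W a b].
Proof.
move=> FF /compact_near_coveringP cQ QW.
have H y : Q y -> \forall y' \near y & i \near powerset_filter_from F,
    [set b | forall a, i a -> W a b]°%classic y'.
  move=> /QW [A [B [FA By AB]]].
  exists (B°, [set i | F i /\ i `<=` A])%classic => /=.
    split; first by exact: nbhs_interior By.
    exists [set i | F i /\ i `<=` A]; last by [].
    split=> //; last by exists A; split.
      by move=> i [].
    by move=> i j [Fi iA] Fj ji; split => //; exact: subset_trans iA.
  move=> [b i] [/= Bb [_ iA]]; move: Bb; apply: filterS => b' Bb' a /iA Aa.
  exact: AB.
have := cQ _ (powerset_filter_from F)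
  (fun i y => [set b | forall a, i a -> W a b]° y) (powerset_filter_from_filter
    FF) H.
case=> M [MF _ [A MA]] MH.
exists A, ([set b | forall a, A a -> W a b]°)%classic; split => //.
- exact: MF.
- exact: open_interior.
- exact: (MH A MA).
by move=> a b Aa /interior_subset; exact.
Qed.

Lemma tube (X Y : topologicalType) (P : set X) (Q : set Y) (W : set (X * Y)) :
  compact P -> compact Q -> open W -> P `*` Q `<=` W ->
  exists U V, [/\ open U, open V, P `<=` U, Q `<=` V & U `*` V `<=` W].
Proof.
move=> cP cQ oW PQW.
(* The neighborhoods of [Q] form a proper filter only if [Q] is nonempty. *)
have [Q0|/set0P Qn0] := eqVneq Q set0.
  by exists setT, set0; rewrite Q0 setX0; split=> //;
    [exact: openT|exact: open0].
have [|A [V [/set_nbhsP [B [oB QB BA]] oV PV AV]]] :=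
    @tube_filter Y X (set_nbhs Q) P (fun y x => W (x, y)) (set_nbhs_pfilter Qn0)
      cP; last first.
  by exists V, B; split=> // -[x y] [/= Vx /BA Ay]; exact: AV.
move=> x Px.
have [|A [V [nA oV QV AV]]] :=
    @tube_filter X Y (nbhs x) Q (fun x y => W (x, y)) _ cQ.
  move=> y Qy; have : nbhs (x, y) W by apply: open_nbhs_nbhs; split => //;
    exact: PQW.
  by case=> -[A B] /= [nA nB] AB; exists A, B; split=> // a b Aa Bb; exact: AB.
exists V, A; split => //; first by apply/set_nbhsP; exists V; split.
by move=> a b Va Ab; exact: AV.
Qed.

(** Hausdorffness puts the product of [P] and [Q] inside the interior of the complement of the
    diagonal, where the tube lemma applies. *)
Lemma compact_sep (X : topologicalType) (P Q : set X) : hausdorff_space X ->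
  compact P -> compact Q -> P `&` Q = set0 ->
  exists U V, [/\ open U, open V, P `<=` U, Q `<=` V & U `&` V = set0].
Proof.
move=> hX cP cQ PQ0.
pose W : set (X * X) := ([set z | z.1 <> z.2]°)%classic.
have [||U [V [oU oV PU QV UV]]] := @tube X X P Q W cP cQ.
- exact: open_interior.
- move=> [x y] [/= Px Qy].
  have xy : x <> y.
    by move=> xy; suff: set0 x by []; rewrite -PQ0; split=> //; rewrite xy.
  have [A [B [nA nB AB]]] := hausdorff_sep hX xy.
  exists (A, B) => // -[a b] [/= Aa Bb] ab; suff: set0 a by [].
  by rewrite -AB; split=> //; rewrite ab.
exists U, V; split=> //; rewrite -subset0 => x [Ux Vx].
by have /interior_subset := UV (x, x) (conj Ux Vx).
Qed.

(* [kcover] describes k_omega-spaces: Hausdorff spaces whose closed sets are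
   detected by an increasing sequence of compact stages. Classifying spaces are
   not locally compact, and it is this notion which survives in products. *)
Section CompactStages.
Variables (X : topologicalType) (I : nat -> finType) (C : nat ->
  topologicalType).
Variable (q : forall n, I n -> C n -> X).

Definition stage (n : nat) : set X := [set x | exists i c, q (n := n) i c = x].

Record kcover : Prop := {
  kc_hausdorff : hausdorff_space X;
  kc_compact : forall n, compact [set: C n];
  kc_continuous : forall n i, continuous (@q n i);
  kc_mono : forall n, stage n `<=` stage n.+1;
  kc_cover : forall x, exists n, stage n x;
  kc_closed : forall A : set X,
    (forall n i, closed (@q n i @^-1` A)) -> closed A }.

Hypothesis kq : kcover.

Lemma stageS m n : (m <= n)%N -> stage m `<=` stage n.
Proof.
move=> /subnK <-; elim: (n - m)%N => [//|k IH]; apply: subset_trans IH _.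
exact: kc_mono.
Qed.

Lemma stageE (n : nat) (A : set X) :
  A `&` stage n = \big[setU/set0]_(i <- enum (I n)) (@q n i @` (@q n i @^-1`
    A)).
Proof.
rewrite -bigcup_seq; apply/seteqP;
  split => [x [Ax [i [c cx]]]|x [i _ [c Ac <-]]].
  by exists i; [rewrite /= mem_enum|exists c => //; rewrite /preimage /= cx].
by split=> //; exists i, c.
Qed.

Lemma stage_compact (n : nat) (A : set X) :
  (forall i, closed (@q n i @^-1` A)) -> compact (A `&` stage n).
Proof.
move=> clA; rewrite stageE; apply: bigsetU_compact => i _.
apply: continuous_compact.
  by apply: continuous_subspaceT; exact: kc_continuous.
by apply: (subclosed_compact (clA i) (@kc_compact kq n)) => ?.
Qed.

Lemma stage_is_compact n : compact (stage n).
Proof.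
rewrite -[stage n]setTI; apply: stage_compact => i.
by rewrite preimage_setT; exact: closedT.
Qed.

Lemma kc_continuousP (Z : topologicalType) (f : X -> Z) :
  (forall n i, continuous (f \o @q n i)) -> continuous f.
Proof.
move=> cf; apply/continuous_closedP => D clD.
apply: (kc_closed kq) => n i; rewrite -comp_preimage.
by move/continuous_closedP : (cf n i); exact.
Qed.

End CompactStages.

Section StageProduct.
Variables (X Y : topologicalType) (I J : nat -> finType).
Variables (C D : nat -> topologicalType).
Variables (q : forall n, I n -> C n -> X) (r : forall n, J n -> D n -> Y).
Hypotheses (kq : kcover q) (kr : kcover r).

Definition prod_param (n : nat) (ij : I n * J n) (c : C n * D n) :
  (X * Y)%type := (q ij.1 c.1, r ij.2 c.2).

Lemma prod_stage n : stage prod_param n = stage q n `*` stage r n.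
Proof.
apply/seteqP; split => [_ [[i j] [[c d] <-]]|[x y] [[i [c /= <-]] [j [d /=
  <-]]]].
  by split; [exists i, c|exists j, d].
by exists (i, j), (c, d).
Qed.

Lemma prod_param_continuous n ij : continuous (@prod_param n ij).
Proof.
move=> c; apply: cvg_pair; apply: continuous_comp.
- exact: cvg_fst.
- exact: kc_continuous.
- exact: cvg_snd.
- exact: kc_continuous.
Qed.

Lemma prod_stage_compact n (A : set (X * Y)) :
  (forall ij, closed (@prod_param n ij @^-1` A)) ->
  compact (A `&` stage prod_param n).
Proof.
move=> clA; rewrite stageE; apply: bigsetU_compact => i _.
apply: continuous_compact.
  by apply: continuous_subspaceT; exact: prod_param_continuous.
have cC : compact [set: C n * D n].
  by rewrite -setXTT; apply: compact_setX;
    [exact: (kc_compact kq)|exact: (kc_compact kr)].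
by apply: (subclosed_compact (clA i) cC) => ?.
Qed.

(* The open neighborhoods of the compact sets [P], [Q] given by the tube lemma
   are shrunk to compact ones inside the stage [n]. *)
Lemma prod_grow n (A : set (X * Y)) (P : set X) (Q : set Y) :
  closed (A `&` (stage q n `*` stage r n)) -> compact P -> compact Q ->
  P `<=` stage q n -> Q `<=` stage r n -> (P `*` Q) `&` A = set0 ->
  exists P' Q' U V, [/\ compact P', compact Q', P' `<=` stage q n,
    Q' `<=` stage r n & (P' `*` Q') `&` A = set0] /\
    [/\ open U, open V, P `<=` U /\ Q `<=` V, U `&` stage q n `<=` P' &
       V `&` stage r n `<=` Q'].
Proof.
move=> clA cP cQ PK QL PQA.
have [||U [V [oU oV PU QV UVA]]] :=
    @tube X Y P Q (~` (A `&` (stage q n `*` stage r n))) cP cQ.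
- exact: closed_openC.
- by move=> z PQz [Az _]; suff: set0 z by []; rewrite -PQA.
have shrink (Z : topologicalType) (K T W : set Z) : hausdorff_space Z ->
    compact K -> compact T -> T `<=` K -> open W -> T `<=` W ->
    exists T' O, [/\ compact T', T' `<=` K, T' `<=` W, open O &
      T `<=` O /\ O `&` K `<=` T'].
  move=> hZ cK cT TK oW TW.
  have cKW : compact (K `&` ~` W) by apply: compact_closedI => //;
    exact: open_closedC.
  have [|O [N [oO oN TO KN ON]]] := compact_sep hZ cT cKW.
    by rewrite -subset0 => z [/TW ? []].
  exists (K `&` ~` N), O; split.
  - by apply: compact_closedI => //; exact: open_closedC.
  - exact: subIsetl.
  - by move=> z [Kz Nz]; apply: contrapT => Wz; apply: Nz; exact: KN.
  - by [].
  - split=> // z [Oz Kz]; split => // Nz; suff: set0 z by [].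
    by rewrite -ON.
have [P' [N [cP' P'K P'U oN [PN NP']]]] :=
  shrink X _ _ _ (kc_hausdorff kq) (@stage_is_compact _ _ _ _ kq n) cP PK oU PU.
have [Q' [N' [cQ' Q'K Q'V oN' [QN NQ']]]] :=
  shrink Y _ _ _ (kc_hausdorff kr) (@stage_is_compact _ _ _ _ kr n) cQ QL oV QV.
exists P', Q', N, N'; split; split => //.
rewrite -subset0 => -[x y] [[/= P'x Q'y] Axy].
apply: (UVA (x, y)); first by split; [exact: P'U|exact: Q'V].
by split=> //; split; [exact: P'K|exact: Q'K].
Qed.

(** The substance is the last clause. Around a point outside [A], boxes of compact sets avoiding [A]
    are grown by dependent choice, one stage at a time. Each factor contains a neighborhood, within
    its stage, of the preceding one; hence the unions of the factors are open, and their product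
    still avoids [A]. *)
Lemma kcover_prod : kcover prod_param.
Proof.
split.
- exact: hausdorff_prod (kc_hausdorff kq) (kc_hausdorff kr).
- by move=> n; rewrite -setXTT; apply: compact_setX;
    [exact: (kc_compact kq)|exact: (kc_compact kr)].
- exact: prod_param_continuous.
- move=> n; rewrite !prod_stage => -[x y] [/= qx ry].
  by split; [exact: (kc_mono kq)|exact: (kc_mono kr)].
- move=> [x y]; have [m qx] := kc_cover kq x; have [n ry] := kc_cover kr y.
  exists (maxn m n); rewrite prod_stage.
  by split; [apply: (stageS kq _ qx)|apply: (stageS kr _ ry)];
    rewrite leq_max leqnn ?orbT.
move=> A clA; rewrite -[A]setCK; apply: open_closedC.
have clAn n : closed (A `&` (stage q n `*` stage r n)).
  rewrite -prod_stage; apply: compact_closed; last exact: prod_stage_compact.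
  exact: hausdorff_prod (kc_hausdorff kq) (kc_hausdorff kr).
rewrite openE => -[x0 y0] A0.
have [m [qx ry]] : exists m, stage q m x0 /\ stage r m y0.
  have [m qx] := kc_cover kq x0; have [n ry] := kc_cover kr y0.
  exists (maxn m n).
  by split; [apply: (stageS kq _ qx)|apply: (stageS kr _ ry)];
    rewrite leq_max leqnn ?orbT.
pose inv (z : nat * (set X * set Y)) := [/\ compact z.2.1, compact z.2.2,
  z.2.1 `<=` stage q (m + z.1), z.2.2 `<=` stage r (m + z.1) &
  (z.2.1 `*` z.2.2) `&` A = set0].
pose R (z w : {z | inv z}) := (sval w).1 = (sval z).1.+1 /\
  exists U V, [/\ open U, open V, (sval z).2.1 `<=` U /\ (sval z).2.2 `<=` V,
    U `&` stage q (m + (sval w).1) `<=` (sval w).2.1 &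
    V `&` stage r (m + (sval w).1) `<=` (sval w).2.2].
have inv0 : inv (0%N, ([set x0], [set y0])).
  split; [exact: compact_set1|exact: compact_set1|..] => /=.
  - by rewrite addn0 => _ ->.
  - by rewrite addn0 => _ ->.
  - by rewrite -subset0 => -[_ _] [[/= -> ->]].
have Rex z : {w | R z w}.
  case: z => [[n [P Q]] [cP cQ PK QL PQA]] /=; apply/cid.
  have [||P' [Q' [U [V [[cP' cQ' P'K Q'L PQA'] UV]]]]] :=
    prod_grow (clAn (m + n.+1)%N) cP cQ _ _ PQA.
  - by apply: subset_trans PK _; rewrite addnS; exact: (kc_mono kq).
  - by apply: subset_trans QL _; rewrite addnS; exact: (kc_mono kr).
  by exists (exist inv (n.+1, (P', Q')) (And5 cP' cQ' P'K Q'L PQA'));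
    split=> //;
     exists U, V.
have [f [f0 fS]] := dependent_choice Rex (exist inv _ inv0).
have fn n : (sval (f n)).1 = n by elim: n => [|n IH];
  rewrite ?f0 // (fS n).1 IH.
pose P n := (sval (f n)).2.1; pose Q n := (sval (f n)).2.2.
have Pq n : P n `<=` stage q (m + n).
  by rewrite -{2}(fn n); case: (svalP (f n)).
have Qr n : Q n `<=` stage r (m + n).
  by rewrite -{2}(fn n); case: (svalP (f n)).
have PU n : exists2 U, open U & P n `<=` U /\ U `&` stage q (m + n.+1) `<=`
  P n.+1.
  by have [_ [U [V [oU _ [? _] + _]]]] := fS n; rewrite fn => ?; exists U.
have QV n : exists2 V, open V & Q n `<=` V /\ V `&` stage r (m + n.+1) `<=`
  Q n.+1.
  by have [_ [U [V [_ oV [_ ?] _]]]] := fS n; rewrite fn => ?; exists V.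
have grow (Z : topologicalType) (I' : nat -> finType) (C' : nat ->
  topologicalType)
    (q' : forall n, I' n -> C' n -> Z) (S : nat -> set Z) : kcover q' ->
    (forall n, S n `<=` stage q' (m + n)) ->
    (forall n, exists2 U, open U & S n `<=` U /\ U `&` stage q' (m + n.+1) `<=`
      S n.+1) ->
    (forall n k, (n <= k)%N -> S n `<=` S k) /\ open (\bigcup_n S n).
  move=> kq' Sq SU.
  have Smono n k : (n <= k)%N -> S n `<=` S k.
    move=> /subnK <-; elim: (k - n)%N => [//|j IH]; apply: subset_trans IH _.
    have [U _ [SU1 US]] := SU (j + n)%N => z Sz; apply: US; split;
      first exact: SU1.
    by apply: (stageS kq' _ (Sq _ _ Sz)); rewrite leq_add2l leqnSn.
  split=> //; rewrite -[\bigcup_n S n]setCK; apply: closed_openC.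
  apply: (kc_closed kq') => n i; rewrite preimage_setC; apply: open_closedC.
  (* The parameter [c] belongs to stage [n] while its image lies in [S k]; raising both indices to
     their maximum lets the growth condition apply to all of stage [n]. *)
  rewrite openE => c [k _ Sc]; have Sc' := Smono k (maxn n k) (leq_maxr _ _)
    _ Sc.
  have [U oU [SU1 US]] := SU (maxn n k).
  have : nbhs c (q' n i @^-1` U).
    apply: kc_continuous => //; apply: open_nbhs_nbhs; split=> //; exact: SU1.
  apply: filterS => d Ud; exists (maxn n k).+1 => //; apply: US; split => //.
  apply: (stageS kq' (m := n)); last by exists i, d.
  by rewrite addnS (leq_trans (leq_maxl n k)) // leqW // leq_addl.
have [Pm oP] := grow X I C q P kq Pq PU.
have [Qm oQ] := grow Y J D r Q kr Qr QV.
exists (\bigcup_n P n, \bigcup_n Q n).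
  split; apply: open_nbhs_nbhs; split=> //; exists 0%N => //.
    by rewrite /P f0.
  by rewrite /Q f0.
move=> [x y] [[k _ Px] [l _ Qy]] Axy.
have [_ _ _ _] := svalP (f (maxn k l)); rewrite -subset0 => /(_ (x, y)); apply.
by split=> //; split; [apply: Pm Px|apply: Qm Qy]; rewrite ?leq_maxl ?leq_maxr.
Qed.

End StageProduct.

(** * Weighted words *)

Lemma set_type_compact (X : topologicalType) (A : set X) :
  compact A -> compact [set: set_type A].
Proof.
move=> cA F PF _.
have PF' : ProperFilter (val @ F) by exact: fmap_proper_filter.
have FA : (val @ F) A by apply: (@filterS _ F _ setT) filterT => x _;
  exact: set_valP.
have [p [Ap clp]] := cA _ PF' FA.
exists (exist _ p (mem_set Ap)); split=> // B C FB.
case=> D [[W oW <-] /= Wp] /= WC.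
have [z [[y By <-] Wz]] : (val @` B `&` W) !=set0.
  apply: clp; last exact: open_nbhs_nbhs.
  by apply: (@filterS _ F _ B) FB => y By; exists y.
by exists y; split=> //; exact: WC.
Qed.

(** * Coordinates on the standard simplex *)

Section Coordinates.
Variable R : realType.

Lemma scoord_continuous n k : continuous (fun t : 'rV[R]_n => scoord t k).
Proof.
case: k => [|k]; first exact: cst_continuous.
rewrite /scoord; case: insubP => [i _ _|_]; last exact: cst_continuous.
exact: coord_continuous.
Qed.

Lemma row_continuous (X : topologicalType) n (f : X -> 'rV[R]_n) :
  (forall i, continuous (fun x => f x 0 i)) -> continuous f.
Proof.
move=> cf x A [P xP PA].
suff : \forall y \near x, forall i j, P i j (f y i j).
  by apply: filterS => y Py; exact: PA.
have FF : Filter (nbhs x) by exact: nbhs_filter.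
apply: (@filter_forall _ _ (fun i => [set y | forall j, P i j (f y i j)]) _ FF)
  => i.
apply: (@filter_forall _ _ (fun j => [set y | P i j (f y i j)]) _ FF) => j.
by have := cf j x; rewrite !(ord1 i); apply; rewrite -(ord1 i); exact: xP.
Qed.

Lemma le_continuous_closed (X : topologicalType) (f g : X -> R) :
  continuous f -> continuous g -> closed [set x | f x <= g x].
Proof.
move=> cf cg; rewrite (_ : mkset _ = (g \- f) @^-1` [set r | 0 <= r]).
  apply: preimage_closed; last exact: closed_ge.
  by move=> x _; apply: continuousB; [exact: cg|exact: cf].
by apply/seteqP; split=> x /=; rewrite subr_ge0.
Qed.

Lemma lt_continuous_open (X : topologicalType) (f g : X -> R) :
  continuous f -> continuous g -> open [set x | f x < g x].
Proof.
move=> cf cg; rewrite -[mkset _]setCK; apply: closed_openC.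
rewrite (_ : ~` _ = [set x | g x <= f x]); first exact: le_continuous_closed.
by apply/seteqP; split=> x /=; rewrite leNgt => /negP.
Qed.

Lemma scoord_ge0 n (t : 'rV[R]_n) k : std_simplex R n t -> 0 <= scoord t k.
Proof.
move=> ht; have [kn|nk] := leqP k n; last by rewrite scoord_out.
by rewrite -(scoord_out t (ltnSn n)); apply: scoord_le => //; exact: leqW.
Qed.

Lemma scoord_le1 n (t : 'rV[R]_n) k : std_simplex R n t -> scoord t k <= 1.
Proof. by move=> ht; exact: (scoord_le ht (leq0n k)). Qed.

Lemma std_simplex_compact n : compact (std_simplex R n).
Proof.
have cI : compact [set v : 'rV[R]_n | forall i, v ord0 i \in `[(0 : R), 1]].
  by apply: (@rV_compact R _ (fun=> `[(0 : R), 1]%classic)) => _;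
    exact: segment_compact.
apply: subclosed_compact cI _; last first.
  move=> t ht i; rewrite /= in_itv /= -scoordS.
  by rewrite scoord_ge0 // scoord_le1.
rewrite (_ : std_simplex R n = \bigcap_(k in [set k | (k <= n)%N])
   [set t | scoord t k.+1 <= scoord t k]); last by apply/seteqP; split.
apply: closed_bigI => k _; apply: le_continuous_closed;
  exact: scoord_continuous.
Qed.

Lemma simplex_compact n : compact [set: set_type (std_simplex R n)].
Proof. exact: set_type_compact (@std_simplex_compact n). Qed.

Definition mksimplex n (t : 'rV[R]_n) (ht : std_simplex R n t) :
  set_type (std_simplex R n) :=
  exist (fun x => x \in std_simplex R n) t (mem_set ht).

End Coordinates.

Section Words.
Variables (R : realType) (M : finType).

(* [wspace] is the fat realization of the semi-simplicial set of words in the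
   alphabet [M], whose faces delete letters. The point of coordinates [t] of the
   simplex of the word [a] is encoded by the list of the letters with nonzero
   barycentric coordinate, which decides the gluing. *)
Definition weight n (t : 'rV[R]_n) (i : nat) : R := scoord t i - scoord t i.+1.

(** Only the values of [a] at [0, ..., n] count. With words as functions on [nat], deleting the
    letter [i] is composition with [bump i]. *)
Definition wlist n (a : nat -> M) (t : 'rV[R]_n) : seq (M * R) :=
  mkseq (fun i => (a i, weight t i)) n.+1.

Definition nz (l : seq (M * R)) : seq (M * R) := [seq p <- l | p.2 != 0].

Definition is_word (l : seq (M * R)) : bool :=
  `[< exists n a (t : 'rV[R]_n), std_simplex R n t /\ l = nz (wlist a t) >].

Definition wspace : Type := {l : seq (M * R) | is_word l}.
HB.instance Definition _ := Choice.on wspace.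

Lemma is_word_nz n a (t : set_type (std_simplex R n)) :
  is_word (nz (wlist a (val t))).
Proof. by apply/asboolP; exists n, a, (val t); split=> //; exact: set_valP. Qed.

Definition wpt n (a : nat -> M) (t : set_type (std_simplex R n)) : wspace :=
  exist (fun l => is_word l) _ (is_word_nz a t).

Lemma wpt_surj (e : wspace) : exists n a t, e = @wpt n a t.
Proof.
case: e => l Hl; have /asboolP [n [a [t [ht lE]]]] := Hl.
by exists n, a, (exist _ t (mem_set ht)); apply: val_inj.
Qed.

Definition wspace_open (U : set wspace) : Prop :=
  forall n a, open (@wpt n a @^-1` U).

Fact wspace_openT : wspace_open setT.
Proof. by move=> n a; rewrite preimage_setT; exact: openT. Qed.

Fact wspace_openI : setI_closed wspace_open.
Proof. by move=> U V oU oV n a; rewrite preimage_setI; exact: openI. Qed.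

Fact wspace_open_bigU (I : Type) (f : I -> set wspace) :
  (forall i, wspace_open (f i)) -> wspace_open (\bigcup_i f i).
Proof.
by move=> of_ n a; rewrite preimage_bigcup; apply: bigcup_open => i _;
  exact: of_.
Qed.

HB.instance Definition _ := isOpenTopological.Build wspace
  wspace_openT wspace_openI wspace_open_bigU.

Lemma wpt_continuous n a : continuous (@wpt n a).
Proof. by apply/continuousP => U; exact. Qed.

Lemma wspace_closedP (A : set wspace) :
  (forall n a, closed (@wpt n a @^-1` A)) -> closed A.
Proof.
move=> clA; rewrite -[A]setCK; apply: open_closedC.
have H : wspace_open (~` A).
  by move=> n a; rewrite preimage_setC; exact: (closed_openC (clA n a)).
exact: H.
Qed.

Lemma wspace_continuous (Z : topologicalType) (f : wspace -> Z) :
  (forall n a, continuous (f \o @wpt n a)) -> continuous f.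
Proof.
move=> cf; apply/continuousP => U oU.
have H : wspace_open (f @^-1` U).
  by move=> n a; rewrite -comp_preimage; move/continuousP: (cf n a); exact.
exact: H.
Qed.

Lemma wpt_ext n (a b : nat -> M) (t u : set_type (std_simplex R n)) :
  (forall i, (i <= n)%N -> a i = b i) -> val t = val u -> wpt a t = wpt b u.
Proof.
move=> ab tu; apply: val_inj;
  change (nz (wlist a (val t)) = nz (wlist b (val u))).
rewrite /wlist tu; congr nz.
by apply/eq_in_map => i; rewrite mem_iota => /andP[_ /ab ->].
Qed.

Lemma nz_cat l l' : nz (l ++ l') = nz l ++ nz l'.
Proof. exact: filter_cat. Qed.

Lemma nz_nz l : nz (nz l) = nz l.
Proof. by rewrite /nz filter_id. Qed.

Lemma nz_wpt (e : wspace) : nz (val e) = val e.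
Proof. by have [n [a [t ->]]] := wpt_surj e; exact: nz_nz. Qed.

Lemma mkseq_cat (T : Type) (f : nat -> T) m n :
  mkseq f (m + n) = mkseq f m ++ mkseq (fun i => f (m + i)%N) n.
Proof. by rewrite /mkseq iotaD map_cat add0n -[X in iota X n]addn0 iotaDl
  -map_comp. Qed.

(** [coface i] repeats a coordinate, so the letter [i] has weight 0 and [nz] erases it. *)
Lemma wlist_coface n i a (t : 'rV[R]_n) : (i <= n.+1)%N ->
  nz (wlist a (coface i t)) = nz (wlist (a \o bump i) t).
Proof.
move=> le_i; rewrite /wlist.
have -> : n.+2 = (i + (1 + (n.+1 - i)))%N by lia.
set g := (fun j => ((a \o bump i) j, _)).
have -> : mkseq g n.+1 = mkseq g (i + (n.+1 - i)) by congr mkseq; lia.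
rewrite {}/g !mkseq_cat !nz_cat /= /weight !addn0 !scoord_cofaceE //.
rewrite leqnn ltnn /= subrr eqxx /=; congr (_ ++ _).
  congr nz; apply/eq_in_map => k; rewrite mem_iota add0n => /andP[_ ki] /=.
  by rewrite !scoord_cofaceE // (ltnW ki) ki /bump leqNgt ki.
congr nz; apply/eq_map => k /=.
rewrite !scoord_cofaceE // add1n addnS !ifF /=; [|lia..].
by rewrite /bump leq_addr add1n.
Qed.

End Words.

(** * Functions separating weighted words *)

Section Patterns.
Variables (R : realType) (M : finType).

(* The sum, over the occurrences of the letters of [P] as a subsequence of [l],
   of the products of powers of their weights; a letter of weight [0] does not
   contribute. These functions separate the points of [wspace]. *)
Fixpoint pattern (P : seq (M * nat)) (l : seq (M * R)) : R :=
  match P, l with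
  | [::], _ => 1
  | _, [::] => 0
  | b :: P', p :: l' =>
    pattern P l' + (if b.1 == p.1 then p.2 ^+ b.2.+1 * pattern P' l' else 0)
  end.

Lemma pattern0 l : pattern [::] l = 1. Proof. by case: l. Qed.

Lemma pattern_nz P l : pattern P (nz l) = pattern P l.
Proof.
elim: l P => [|p l IH] [|b P] //=; first by rewrite pattern0.
case: ifP => [_|/negbFE/eqP p0] /=; first by rewrite !IH.
by rewrite IH p0 expr0n mul0r if_same addr0.
Qed.

Lemma pattern_continuous (X : topologicalType) P s (a : nat -> M) (w : nat ->
  X -> R) :
  (forall i, continuous (w i)) ->
  continuous (fun x => pattern P [seq (a i, w i x) | i <- s]).
Proof.
move=> cw; elim: s P => [|i s IH] [|b P] //=; do ?exact: cst_continuous.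
move=> x; apply: continuousD; first exact: IH.
case: (b.1 == a i); last exact: cvg_cst.
apply: continuousM; last exact: IH.
by apply: (continuous_comp (g := fun r : R => r ^+ b.2.+1));
  [exact: cw|exact: exprn_continuous].
Qed.

Lemma pattern_short P l : (size l < size P)%N -> pattern P l = 0.
Proof.
elim: l P => [|p l IH] [|b P] //= lP.
by rewrite !IH ?mulr0 ?if_same ?addr0 //; exact: leq_trans (leqnSn _) lP.
Qed.

Definition pattern_of (l : seq (M * R)) : seq (M * nat) :=
  [seq (p.1, 0%N) | p <- l].

Lemma pattern_of_neq0 (l : seq (M * R)) : all (fun p : M * R => p.2 != 0) l ->
  pattern (pattern_of l) l != 0.
Proof.
elim: l => [_|p l IH] /=; first exact: oner_neq0.
move=> /andP[p0 /IH l0]; rewrite pattern_short ?add0r;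
  last by rewrite /= size_map.
by rewrite eqxx mulf_neq0 // expr1.
Qed.

(** A pattern as long as the word occurs at most once, so its value is 0 or a single product. A
    nonzero product for [l] forces the first letters to agree; raising the exponent of the first
    weight from 1 to 2 multiplies this common product by [w] on one side and by [w'] on the other,
    so the weights agree too. *)
Lemma pattern_inj_size n (l l' : seq (M * R)) : size l = n -> size l' = n ->
  all (fun p : M * R => p.2 != 0) l ->
  (forall P, size P = n -> pattern P l = pattern P l') -> l = l'.
Proof.
elim: n l l' => [|n IH] [|[a w] l] [|[a' w'] l'] //= [sl] [sl'] /andP[/= w0 l0]
  H.
have E b k P : size P = n ->
    (if b == a then w ^+ k.+1 * pattern P l else 0) =
    (if b == a' then w' ^+ k.+1 * pattern P l' else 0).
  move=> sP; have := H ((b, k) :: P); rewrite /= sP => /(_ erefl).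
  rewrite (@pattern_short (_ :: _) l) ?(@pattern_short (_ :: _) l') ?add0r
    ?add0r //.
    by rewrite /= ltnS sl' sP.
  by rewrite /= ltnS sl sP.
have sPl : size (pattern_of l) = n by rewrite size_map.
have pl0 := pattern_of_neq0 l0.
have aa' : a = a'.
  have := E a 0%N _ sPl; rewrite eqxx; case: eqP => // _ /eqP.
  by rewrite mulf_eq0 expr1 (negbTE w0) (negbTE pl0).
have E0 := E a 0%N _ sPl; have E1 := E a 1%N _ sPl.
move: E0 E1; rewrite -aa' eqxx !expr1 => E0; rewrite !expr2 -!mulrA -E0.
have c0 : w * pattern (pattern_of l) l != 0 by rewrite mulf_neq0.
move=> /(mulIf c0) ww'; rewrite -ww'; congr cons.
apply: IH => // P sP; have := E a 0%N P sP.
by rewrite -aa' eqxx !expr1 -ww' => /(mulfI w0).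
Qed.

(** The pattern of the longer word does not vanish on it but vanishes on every shorter word, which
    reduces to equal lengths. *)
Lemma pattern_inj (l l' : seq (M * R)) :
  all (fun p : M * R => p.2 != 0) l -> all (fun p : M * R => p.2 != 0) l' ->
  (forall P, pattern P l = pattern P l') -> l = l'.
Proof.
wlog ll' : l l' / (size l' <= size l)%N.
  move=> W l0 l0' H; have [?|/ltnW ?] := leqP (size l') (size l);
    first exact: W.
  by apply/esym/W.
move=> l0 l0' H; apply: (@pattern_inj_size (size l)) => //.
apply/eqP; rewrite eqn_leq ll' leqNgt; apply/negP => lt.
have := pattern_of_neq0 l0; rewrite H pattern_short ?eqxx //.
by rewrite size_map.
Qed.

End Patterns.

(** * The space of weighted words as a k_omega-space *)

Section WordSpace.
Variables (R : realType) (M : finType).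
Local Notation E := (wspace R M).

Lemma val_wpt n a t : val (@wpt R M n a t) = nz (wlist a (val t)).
Proof. by []. Qed.

Lemma wspace_neq0 (e : E) : all (fun p : M * R => p.2 != 0) (val e).
Proof. by have [n [a [t ->]]] := wpt_surj e; exact: filter_all. Qed.

Lemma simplex_val_continuous n :
  continuous (val : set_type (std_simplex R n) -> 'rV[R]_n).
Proof. exact: initial_continuous. Qed.

Lemma scoord_val_continuous n k :
  continuous (fun t : set_type (std_simplex R n) => scoord (val t) k).
Proof.
move=> t; exact: (continuous_comp (@simplex_val_continuous n t)
  (@scoord_continuous R n k (val t))).
Qed.

Lemma weight_continuous n k :
  continuous (fun t : set_type (std_simplex R n) => weight (val t) k).
Proof.
by move=> t; exact: (continuousB (@scoord_val_continuous n k t)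
  (@scoord_val_continuous n k.+1 t)).
Qed.

Lemma pattern_val_continuous P : continuous (fun e : E => pattern P (val e)).
Proof.
apply: wspace_continuous => n a.
rewrite (_ : _ \o _ = (fun t => pattern P [seq (a i, weight (val t) i) | i <-
  iota 0 n.+1])).
  exact: pattern_continuous (@weight_continuous n).
by apply/funext => t; rewrite /comp val_wpt pattern_nz.
Qed.

Lemma wspace_hausdorff : hausdorff_space E.
Proof.
move=> e e' cl; apply: val_inj; apply: pattern_inj; [exact: wspace_neq0..|].
move=> P; apply: (@Rhausdorff R) => A B nA nB.
have [z [Az Bz]] := cl _ _ (pattern_val_continuous nA)
  (pattern_val_continuous nB).
by exists (pattern P (val z)).
Qed.

Lemma wpt_coface n i (a : nat -> M) (t : set_type (std_simplex R n))
    (u : set_type (std_simplex R n.+1)) : (i <= n.+1)%N ->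
  val u = coface i (val t) -> wpt a u = wpt (a \o bump i) t.
Proof. by move=> le_i uE; apply: val_inj; rewrite !val_wpt uE wlist_coface. Qed.

(** Each stage of a [kcover] needs finitely many simplices, hence words on ['I_n.+1] instead of
    [nat]. *)
Definition simplex_index n : finType := {ffun 'I_n.+1 -> M}.

Definition wpt_param n (f : simplex_index n) (t : set_type (std_simplex R n)) :
  E :=
  wpt (f \o inord) t.

Lemma wpt_paramE n (a : nat -> M) : exists f, wpt a = @wpt_param n f.
Proof.
exists [ffun i => a (val i)]; apply/funext => t; apply: wpt_ext => // i le_i.
by rewrite /= ffunE /= inordK.
Qed.

Lemma stage_wptP n (e : E) : stage wpt_param n e <-> exists a t,
  e = @wpt R M n a t.
Proof.
split=> [[f [t <-]]|[a [t ->]]]; first by exists (f \o inord), t.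
by have [f ->] := wpt_paramE n a; exists f, t.
Qed.

Lemma wspace_kcover : kcover wpt_param.
Proof.
split.
- exact: wspace_hausdorff.
- by move=> n; exact: simplex_compact.
- by move=> n f; exact: wpt_continuous.
- move=> n e /stage_wptP [a [t ->]]; apply/stage_wptP.
  (* [coface n.+1] appends the coordinate 0, so the additional letter [a n.+1] has weight 0. *)
  exists a, (mksimplex (coface_simplex (leqnn n.+1) (set_valP t))).
  rewrite (@wpt_coface n n.+1 a t) //; apply: wpt_ext => // i le_i /=.
  by rewrite /bump leqNgt ltnS le_i.
- by move=> e; have [n [a [t ->]]] := wpt_surj e; exists n; apply/stage_wptP;
  exists a, t.
- move=> A clA; apply: wspace_closedP => n a.
  by have [f ->] := wpt_paramE n a.
Qed.

(** Constant stages, which make the compact interval a possible factor in [kcover_prod]. *)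
Definition interval_param (n : nat) (_ : unit) (u : unit_interval R) := u.

Lemma unit_interval_compact : compact [set: unit_interval R].
Proof. by apply: set_type_compact; exact: segment_compact. Qed.

Lemma unit_interval_hausdorff : hausdorff_space (unit_interval R).
Proof.
move=> u v cl; apply: val_inj; apply: (@Rhausdorff R) => A B nA nB.
have cval : continuous (val : unit_interval R -> R) by exact:
  initial_continuous.
by have [z [Az Bz]] := cl _ _ (cval _ _ nA) (cval _ _ nB); exists (val z).
Qed.

Lemma interval_kcover :
  @kcover (unit_interval R) (fun=> unit) (fun=> unit_interval R) interval_param.
Proof.
split.
- exact: unit_interval_hausdorff.
- by move=> n; exact: unit_interval_compact.
- by move=> n i u; exact: cvg_id.
- by move=> n u [i [v <-]]; exists tt, v.
- by move=> u; exists 0%N, tt, u.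
- by move=> A /(_ 0%N tt).
Qed.

Lemma wspace_interval_continuous (Z : topologicalType) (f :
  E * unit_interval R -> Z) :
  (forall n (a : nat -> M), continuous
    (fun z : set_type (std_simplex R n) * unit_interval R => f (wpt a z.1,
      z.2))) ->
  continuous f.
Proof.
move=> cf; apply: (kc_continuousP (kcover_prod wspace_kcover interval_kcover)).
move=> n i; exact: (cf n (i.1 \o inord)).
Qed.

End WordSpace.

(** Both words may be taken of the same dimension [n], because the stages of a product share their
    index. *)
Lemma wspace2_interval_continuous (R : realType) (M M' : finType)
    (Z : topologicalType) (f : wspace R M * wspace R M' * unit_interval R ->
      Z) :
  (forall n (a : nat -> M) (b : nat -> M'), continuous
    (fun z : set_type (std_simplex R n) * set_type (std_simplex R n) *
       unit_interval R => f (wpt a z.1.1, wpt b z.1.2, z.2))) ->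
  continuous f.
Proof.
move=> cf.
apply: (kc_continuousP (kcover_prod
  (kcover_prod (wspace_kcover R M) (wspace_kcover R M')) (interval_kcover R))).
move=> n i; exact: (cf n (i.1.1 \o inord) (i.1.2 \o inord)).
Qed.

(** * Concatenating and splitting words *)

Section Operations.
Variable R : realType.

Lemma simplex_continuous (X : topologicalType) n (f : X ->
  set_type (std_simplex R n)) :
  (forall k, continuous (fun x => scoord (val (f x)) k)) -> continuous f.
Proof.
move=> cf; apply: continuous_comp_initial; apply: row_continuous => i.
rewrite (_ : (fun x => _) = (fun x => scoord (val (f x)) i.+1));
  first exact: cf.
by apply/funext => x; rewrite scoordS.
Qed.

Section Map.
Variables (M M' : finType) (f : M -> M').

Definition relabel (l : seq (M * R)) : seq (M' * R) :=
  [seq (f p.1, p.2) | p <- l].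

Lemma nz_relabel l : nz (relabel l) = relabel (nz l).
Proof. exact: filter_map. Qed.

Lemma relabel_wlist n a (t : 'rV[R]_n) : relabel (wlist a t) = wlist (f \o a) t.
Proof. by rewrite /relabel /wlist /mkseq -map_comp. Qed.

Lemma is_word_relabel (e : wspace R M) : is_word (relabel (val e)).
Proof.
have [n [a [t ->]]] := wpt_surj e.
by rewrite val_wpt -nz_relabel relabel_wlist is_word_nz.
Qed.

Definition wmap (e : wspace R M) : wspace R M' :=
  exist (fun l => is_word l) _ (is_word_relabel e).

Lemma val_wmap e : val (wmap e) = relabel (val e).
Proof. by []. Qed.

Lemma wmap_wpt n a t : wmap (@wpt R M n a t) = wpt (f \o a) t.
Proof. by apply: val_inj; rewrite val_wmap !val_wpt -nz_relabel relabel_wlist.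
  Qed.

Lemma wmap_continuous : continuous wmap.
Proof.
apply: wspace_continuous => n a.
rewrite (_ : _ \o _ = wpt (f \o a)); first exact: wpt_continuous.
by apply/funext => t; exact: wmap_wpt.
Qed.

End Map.

Lemma wmap_comp (M M' M'' : finType) (g : M' -> M'') (f : M -> M') e :
  wmap g (wmap f e) = wmap (g \o f) e.
Proof. by apply: val_inj; rewrite !val_wmap /relabel -map_comp. Qed.

Lemma wmap_id (M : finType) (f : M -> M) e : f =1 id -> wmap f e = e.
Proof.
move=> f1; apply: val_inj; rewrite val_wmap -[RHS]map_id;
  apply: eq_map => -[a w].
by rewrite /= f1.
Qed.

Lemma eq_wmap (M M' : finType) (f g : M -> M') e : f =1 g ->
  wmap f e = wmap g e.
Proof. by move=> /funext ->. Qed.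

Section Join.
Variable M : finType.
Implicit Types (s : unit_interval R) (e : wspace R M).

Definition scale (r : R) (l : seq (M * R)) : seq (M * R) :=
  [seq (p.1, r * p.2) | p <- l].

Lemma nz_scale r l : nz (scale r (nz l)) = nz (scale r l).
Proof.
elim: l => [//|p l IH] /=; case: ifPn => [_|/negPn/eqP p0] /=;
  first by rewrite IH.
by rewrite p0 mulr0 eqxx IH.
Qed.

(* The letters of [a] get total weight [s] and precede those of [b]. *)
Definition join_fun n m (t : 'rV[R]_n) (u : 'rV[R]_m) (s : R) (k : nat) : R :=
  if (k <= n)%N then 1 - s + s * scoord t k else (1 - s) * scoord u (k - n.+1).

Definition join_coord n m (t : 'rV[R]_n) (u : 'rV[R]_m) (s : R) :
  'rV[R]_(n + m.+1) := \row_(j < n + m.+1) join_fun t u s j.+1.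

Definition join_word n (a b : nat -> M) (k : nat) : M :=
  if (k <= n)%N then a k else b (k - n.+1)%N.

Lemma scoord_join n m (t : 'rV[R]_n) (u : 'rV[R]_m) (s : R) k :
  scoord (join_coord t u s) k = join_fun t u s k.
Proof.
case: k => [|k]; first by rewrite /join_fun leq0n /scoord mulr1 subrK.
have [lt_k|ge_k] := ltnP k (n + m.+1).
  by rewrite (scoord_row (fun j => join_fun t u s j.+1)).
by rewrite scoord_out ?ltnS // /join_fun ifF ?scoord_out ?mulr0 //; lia.
Qed.

Lemma join_simplex n m (t : 'rV[R]_n) (u : 'rV[R]_m) (s : R) : 0 <= s <= 1 ->
  std_simplex R n t -> std_simplex R m u ->
  std_simplex R (n + m.+1) (join_coord t u s).
Proof.
move=> /andP[s0 s1] ht hu k _; rewrite !scoord_join /join_fun.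
have s1' : 0 <= 1 - s by rewrite subr_ge0.
have [kn|nk|->] := ltngtP k n.
- by rewrite lerD2l ler_wpM2l // scoord_le.
- by rewrite subSS ler_wpM2l // scoord_le //; lia.
- by rewrite subnn mulr1 lerDl mulr_ge0 // scoord_ge0.
Qed.

Lemma wlist_join n m (a b : nat -> M) (t : 'rV[R]_n) (u : 'rV[R]_m) (s : R) :
  wlist (join_word n a b) (join_coord t u s) =
  scale s (wlist a t) ++ scale (1 - s) (wlist b u).
Proof.
rewrite /wlist -addSn mkseq_cat /scale /mkseq -!map_comp; congr (_ ++ _).
  apply/eq_in_map => k; rewrite mem_iota add0n ltnS => /andP[_ kn].
  rewrite /= /join_word /weight !scoord_join /join_fun kn; congr pair.
  case: ltnP => [_|nk]; first by ring.
  (* At the junction the next coordinate is [1 - s], coming from [scoord u 0 = 1]; this matches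
     [scoord t n.+1 = 0]. *)
  have -> : k = n by lia.
  by rewrite subnn (scoord_out t (ltnSn n)) /scoord; ring.
apply/eq_map => k; rewrite /= /join_word /weight !scoord_join /join_fun.
rewrite !ifF; [|lia..].
have -> : (n.+1 + k - n.+1 = k)%N by lia.
have -> : ((n.+1 + k).+1 - n.+1 = k.+1)%N by lia.
by rewrite mulrBr.
Qed.

Lemma is_word_join e e' s :
  is_word (nz (scale (val s) (val e) ++ scale (1 - val s) (val e'))).
Proof.
have [n [a [t ->]]] := wpt_surj e; have [m [b [u ->]]] := wpt_surj e'.
rewrite !val_wpt nz_cat !nz_scale -nz_cat -wlist_join.
apply/asboolP; exists (n + m.+1)%N, (join_word n a b),
  (join_coord (val t) (val u) (val s)).
by split=> //; apply: join_simplex; [exact: unit_intervalP|exact: set_valP..].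
Qed.

(** Defined on lists, hence independent of the representing simplices. The outer [nz] matters at
    [s = 0] and [s = 1], where all letters of one word vanish. *)
Definition wjoin e e' s : wspace R M :=
  exist (fun l => is_word l) _ (is_word_join e e' s).

Lemma val_wjoin e e' s :
  val (wjoin e e' s) = nz (scale (val s) (val e) ++ scale (1 - val s) (val e')).
Proof. by []. Qed.

Lemma wjoin_wpt n m a b t u s :
  wjoin (@wpt R M n a t) (@wpt R M m b u) s =
  wpt (join_word n a b)
    (mksimplex (join_simplex (unit_intervalP s) (set_valP t) (set_valP u))).
Proof. by apply: val_inj; rewrite val_wjoin !val_wpt nz_cat !nz_scale -nz_cat
  -wlist_join. Qed.

Lemma nz_scale1 l : nz (scale 1 l) = nz l.
Proof. by rewrite /scale; congr nz; rewrite -[RHS]map_id;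
  apply: eq_map => -[a w]; rewrite /= mul1r. Qed.

Lemma nz_scale0 l : nz (scale 0 l) = [::].
Proof. by elim: l => [//|p l IH] /=; rewrite mul0r eqxx. Qed.

Lemma wjoin1 e e' : wjoin e e' (unit1 R) = e.
Proof.
by apply: val_inj; rewrite val_wjoin /= subrr nz_cat nz_scale1 nz_scale0 cats0
  nz_wpt.
Qed.

Lemma wjoin0 e e' : wjoin e e' (unit0 R) = e'.
Proof. by apply: val_inj;
  rewrite val_wjoin /= subr0 nz_cat nz_scale1 nz_scale0 nz_wpt. Qed.

Lemma join_fun_continuous (X : topologicalType) n m (t : X -> 'rV[R]_n)
    (u : X -> 'rV[R]_m) (s : X -> R) k :
  (forall j, continuous (fun x => scoord (t x) j)) ->
  (forall j, continuous (fun x => scoord (u x) j)) -> continuous s ->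
  continuous (fun x => join_fun (t x) (u x) (s x) k).
Proof.
move=> ct cu cs; rewrite /join_fun; case: (k <= n)%N => x.
  apply: cvgD; last by apply: cvgM; [exact: cs|exact: ct].
  by apply: cvgB; [exact: cvg_cst|exact: cs].
apply: cvgM; last exact: cu.
by apply: cvgB; [exact: cvg_cst|exact: cs].
Qed.

Lemma wjoin_continuous :
  continuous (fun z : wspace R M * wspace R M * unit_interval R =>
    wjoin z.1.1 z.1.2 z.2).
Proof.
apply: wspace2_interval_continuous => n a b /=.
pose D : topologicalType :=
  (set_type (std_simplex R n) * set_type (std_simplex R n) * unit_interval
    R)%type.
pose f (z : D) := mksimplex
  (join_simplex (unit_intervalP z.2) (set_valP z.1.1) (set_valP z.1.2)).
rewrite (_ : (fun z => _) = wpt (join_word n a b) \o f); last first.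
  by apply/funext => z; exact: wjoin_wpt.
have cf : continuous f; last first.
  by move=> z; apply: continuous_comp; [exact: cf|exact: wpt_continuous].
apply: simplex_continuous => k.
rewrite (_ : (fun z => _) =
  (fun z : D => join_fun (val z.1.1) (val z.1.2) (val z.2) k)); last first.
  by apply/funext => z; rewrite /f scoord_join.
have c1 : continuous (fun z : D => z.1) by move=> z; exact: cvg_fst.
apply: join_fun_continuous => [j z|j z|z].
- apply: (continuous_comp (f := fun z : D => z.1.1)
    (g := fun t : set_type (std_simplex R n) => scoord (val t) j)).
    by apply: continuous_comp; [exact: c1|exact: cvg_fst].
  exact: scoord_val_continuous.
- apply: (continuous_comp (f := fun z : D => z.1.2)
    (g := fun t : set_type (std_simplex R n) => scoord (val t) j)).
    by apply: continuous_comp; [exact: c1|exact: cvg_snd].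
  exact: scoord_val_continuous.
apply: (continuous_comp (f := fun z : D => z.2)
    (g := (val : unit_interval R -> R))); first exact: cvg_snd.
exact: initial_continuous.
Qed.

End Join.

Lemma wmap_join (M M' : finType) (f : M -> M') (e e' : wspace R M) s :
  wmap f (wjoin e e' s) = wjoin (wmap f e) (wmap f e') s.
Proof.
apply: val_inj; rewrite val_wjoin !val_wmap val_wjoin -nz_relabel; congr nz.
by rewrite /relabel /scale map_cat -!map_comp.
Qed.

End Operations.

(** * Cutting words at a level *)

Section Split.
Variables (R : realType) (M : finType).
Implicit Types (u : unit_interval R) (e : wspace R M).

(** The first letter of [l] occupies the segment from [top] down to [top - p.2]; [upper] keeps its
    length above [u], and [lower] its length below. *)
Fixpoint upper (u top : R) (l : seq (M * R)) : seq (M * R) :=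
  if l is p :: l' then
    (p.1, Num.max top u - Num.max (top - p.2) u) :: upper u (top - p.2) l'
  else [::].

Fixpoint lower (u top : R) (l : seq (M * R)) : seq (M * R) :=
  if l is p :: l' then
    (p.1, Num.min u top - Num.min u (top - p.2)) :: lower u (top - p.2) l'
  else [::].

Lemma nz_upper (u : R) top l : nz (upper u top (nz l)) = nz (upper u top l).
Proof.
elim: l top => [//|p l IH] top /=; case: ifPn => [_|/negPn/eqP p0] /=.
  by rewrite IH.
by rewrite p0 subr0 subrr eqxx /= IH.
Qed.

Lemma nz_lower (u : R) top l : nz (lower u top (nz l)) = nz (lower u top l).
Proof.
elim: l top => [//|p l IH] top /=; case: ifPn => [_|/negPn/eqP p0] /=.
  by rewrite IH.
by rewrite p0 subr0 subrr eqxx /= IH.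
Qed.

Lemma upper_wlist n (a : nat -> M) (t : 'rV[R]_n) (u : R) :
  upper u 1 (wlist a t) =
  mkseq (fun i => (a i, Num.max (scoord t i) u - Num.max (scoord t i.+1) u))
    n.+1.
Proof.
rewrite /wlist /mkseq -[1]/(scoord t 0).
elim: n.+1 0%N => [//|k IH] j /=; rewrite /weight subKr.
by congr cons; exact: IH.
Qed.

Lemma lower_wlist n (a : nat -> M) (t : 'rV[R]_n) (u : R) :
  lower u 1 (wlist a t) =
  mkseq (fun i => (a i, Num.min u (scoord t i) - Num.min u (scoord t i.+1)))
    n.+1.
Proof.
rewrite /wlist /mkseq -[1]/(scoord t 0).
elim: n.+1 0%N => [//|k IH] j /=; rewrite /weight subKr.
by congr cons; exact: IH.
Qed.

(* The letters [a 0, ..., a n] keep the part of their segment above the level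
   [u], and a second copy [f (a 0), ..., f (a n)] of them gets the part below
     [u]:
   for the translation [f] by a loop this is the Parmesan path. *)
Definition split_fun n (t : 'rV[R]_n) (u : R) (k : nat) : R :=
  if (k <= n)%N then Num.max (scoord t k) u else Num.min u (scoord t (k -
    n.+1)).

Definition split_coord n (t : 'rV[R]_n) (u : R) : 'rV[R]_(n + n.+1) :=
  \row_(j < n + n.+1) split_fun t u j.+1.

Lemma scoord_split n (t : 'rV[R]_n) (u : R) k : 0 <= u <= 1 ->
  scoord (split_coord t u) k = split_fun t u k.
Proof.
move=> /andP[u0 u1].
case: k => [|k]; first by rewrite /split_fun leq0n /scoord max_l.
have [lt_k|ge_k] := ltnP k (n + n.+1).
  by rewrite (scoord_row (fun j => split_fun t u j.+1)).
rewrite scoord_out ?ltnS // /split_fun ifF; last by lia.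
by rewrite scoord_out ?min_r //; lia.
Qed.

Lemma split_simplex n (t : 'rV[R]_n) (u : R) : 0 <= u <= 1 ->
  std_simplex R n t -> std_simplex R (n + n.+1) (split_coord t u).
Proof.
move=> hu ht k _; have /andP[u0 u1] := hu; rewrite !scoord_split // /split_fun.
have [kn|nk|->] := ltngtP k n.
- have st := scoord_le ht (leqnSn k).
  by rewrite ge_max !le_max st lexx orbT.
- rewrite subSS; have st : scoord t (k - n) <= scoord t (k - n.+1).
    by apply: scoord_le => //; lia.
  by rewrite le_min !ge_min st lexx orbT.
- by rewrite subnn ge_min le_max lexx orbT.
Qed.

Variable f : M -> M.

Definition split_word n (a : nat -> M) : nat -> M := join_word n a (f \o a).

Lemma nz_split n (a : nat -> M) (t : 'rV[R]_n) u :
  nz (wlist (split_word n a) (split_coord t (val u))) =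
  nz (upper (val u) 1 (wlist a t) ++ relabel f (lower (val u) 1 (wlist a t))).
Proof.
have hu := unit_intervalP u; have /andP[u0 u1] := hu.
rewrite upper_wlist lower_wlist /wlist -addSn mkseq_cat /relabel /mkseq
  -map_comp.
congr (nz (_ ++ _)).
  apply/eq_in_map => k; rewrite mem_iota add0n ltnS => /andP[_ kn].
  rewrite /= /split_word /join_word /weight !scoord_split // /split_fun kn.
  congr (_, _ - _); case: ltnP => // nk.
  (* At the junction the next coordinate is [Num.min u 1 = u], which agrees with [Num.max 0 u]. *)
  have -> : k = n by lia.
  by rewrite subnn (scoord_out t (ltnSn n)) min_l // max_r.
apply/eq_map => k; rewrite /= /split_word /join_word /weight !scoord_split //
  /split_fun.
rewrite !ifF; [|lia..].
have -> : (n.+1 + k - n.+1 = k)%N by lia.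
by have -> : ((n.+1 + k).+1 - n.+1 = k.+1)%N by lia.
Qed.

Definition split_list u (l : seq (M * R)) : seq (M * R) :=
  nz (upper (val u) 1 l ++ relabel f (lower (val u) 1 l)).

Lemma split_list_nz u l : split_list u (nz l) = split_list u l.
Proof. by rewrite /split_list !nz_cat !nz_relabel nz_upper nz_lower. Qed.

Lemma is_word_split e u : is_word (split_list u (val e)).
Proof.
have [n [a [t ->]]] := wpt_surj e;
  rewrite val_wpt split_list_nz /split_list -nz_split.
apply/asboolP; do 3 eexists; split; last by [].
by apply: split_simplex; [exact: unit_intervalP|exact: set_valP].
Qed.

Definition wsplit e u : wspace R M :=
  exist (fun l => is_word l) _ (is_word_split e u).

Lemma val_wsplit e u : val (wsplit e u) = split_list u (val e).
Proof. by []. Qed.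

Lemma wsplit_wpt n a t u : wsplit (@wpt R M n a t) u =
  wpt (split_word n a) (mksimplex (split_simplex (unit_intervalP u)
    (set_valP t))).
Proof.
by apply: val_inj; rewrite val_wsplit !val_wpt split_list_nz /split_list
  -nz_split.
Qed.

Lemma nz_all0 (T : Type) (g : T -> M) (h : T -> R) s : (forall x, h x = 0) ->
  nz [seq (g x, h x) | x <- s] = [::].
Proof. by move=> h0; elim: s => [//|x s IH] /=; rewrite h0 eqxx. Qed.

Lemma wsplit0 e : wsplit e (unit0 R) = e.
Proof.
have [n [a [t ->]]] := wpt_surj e; have ht := set_valP t.
apply: val_inj; rewrite val_wsplit val_wpt split_list_nz /split_list nz_cat.
rewrite upper_wlist lower_wlist nz_relabel /mkseq.
rewrite [nz [seq (_, Num.min _ _ - _) | _ <- _]]nz_all0 ?cats0 => [|i];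
  last first.
  by rewrite !min_l ?subrr // scoord_ge0.
by congr nz; apply: eq_map => i; rewrite !max_l // scoord_ge0.
Qed.

Lemma wsplit1 e : wsplit e (unit1 R) = wmap f e.
Proof.
have [n [a [t ->]]] := wpt_surj e; have ht := set_valP t.
apply: val_inj; rewrite val_wsplit val_wmap val_wpt split_list_nz /split_list
  nz_cat.
rewrite upper_wlist lower_wlist nz_relabel /mkseq.
rewrite [nz [seq (_, Num.max _ _ - _) | _ <- _]]nz_all0 => [|i]; last first.
  by rewrite !max_r ?subrr // scoord_le1.
by congr relabel; congr nz; apply: eq_map => i; rewrite !min_r // scoord_le1.
Qed.

Lemma split_fun_continuous (X : topologicalType) n (t : X -> 'rV[R]_n)
    (u : X -> R) k : (forall j, continuous (fun x => scoord (t x) j)) ->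
  continuous u -> continuous (fun x => split_fun (t x) (u x) k).
Proof.
move=> ct cu; rewrite /split_fun; case: (k <= n)%N.
  exact: (max_fun_continuous (ct k) cu).
exact: (min_fun_continuous cu (ct _)).
Qed.

Lemma wsplit_continuous :
  continuous (fun z : wspace R M * unit_interval R => wsplit z.1 z.2).
Proof.
apply: wspace_interval_continuous => n a /=.
pose D : topologicalType := (set_type (std_simplex R n) * unit_interval R)%type.
pose g (z : D) := mksimplex (split_simplex (unit_intervalP z.2) (set_valP z.1)).
rewrite (_ : (fun z => _) = wpt (split_word n a) \o g); last first.
  by apply/funext => z; exact: wsplit_wpt.
have cg : continuous g; last first.
  by move=> z; apply: continuous_comp; [exact: cg|exact: wpt_continuous].
apply: simplex_continuous => k.
rewrite (_ : (fun z => _) = (fun z : D => split_fun (val z.1) (val z.2) k));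
  last first.
  by apply/funext => z; rewrite /g scoord_split //; exact: unit_intervalP.
apply: split_fun_continuous => [j z|z].
  apply: (continuous_comp (f := fun z : D => z.1)
    (g := fun t : set_type (std_simplex R n) => scoord (val t) j)).
    exact: cvg_fst.
  exact: scoord_val_continuous.
apply: (continuous_comp (f := fun z : D => z.2)
    (g := (val : unit_interval R -> R))); first exact: cvg_snd.
exact: initial_continuous.
Qed.

End Split.

Lemma wmap_split (R : realType) (M M' : finType) (h : M -> M') (f : M -> M)
    (f' : M' -> M') (e : wspace R M) u : (forall m, h (f m) = f' (h m)) ->
  wmap h (wsplit f e u) = wsplit f' (wmap h e) u.
Proof.
move=> hf; apply: val_inj; rewrite val_wsplit !val_wmap val_wsplit.
rewrite /split_list -nz_relabel; congr nz.
have up l top : relabel h (upper (val u) top l) = upper (val u)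
  top (relabel h l).
  by elim: l top => [//|p l IH] top /=; rewrite IH.
have lo l top : relabel h (lower (val u) top l) = lower (val u)
  top (relabel h l).
  by elim: l top => [//|p l IH] top /=; rewrite IH.
rewrite -up -lo /relabel map_cat -!map_comp; congr (_ ++ _).
by apply: eq_map => p /=; rewrite hf.
Qed.

(** * Letters found at a given level *)

Section Levels.
Variables (R : realType) (M : finType).

(* The words in which the level [c] lies strictly inside the segment of a
   letter [a]. *)
Fixpoint at_level (c : R) (a : M) (top : R) (l : seq (M * R)) : bool :=
  if l is p :: l' then
    (p.1 == a) && (top - p.2 < c < top) || at_level c a (top - p.2) l'
  else false.

Lemma at_level_nz c a top l : at_level c a top (nz l) = at_level c a top l.
Proof.
elim: l top => [//|p l IH] top /=; case: ifPn => [_|/negPn/eqP p0] /=.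
  by rewrite IH.
by rewrite p0 subr0 IH lt_asym andbF.
Qed.

Definition levelset (c : R) (a : M) : set (wspace R M) :=
  [set e | at_level c a 1 (val e)].

Lemma at_level_iota c a (b : nat -> M) (F : nat -> R) k j :
  at_level c a (F j) [seq (b i, F i - F i.+1) | i <- iota j k] <->
  exists i, [/\ (j <= i < j + k)%N, b i = a & F i.+1 < c < F i].
Proof.
elim: k j => [|k IH] j; first by split=> // -[i [+ _ _]]; lia.
rewrite /= subKr; split.
  case/orP => [/andP[/eqP bj hc]|/IH [i [ji bi hc]]].
    by exists j; split=> //; lia.
  by exists i; split=> //; lia.
case=> i [ji bi hc]; have [ij|ij] := eqVneq i j.
  by rewrite -ij bi eqxx hc.
by apply/orP; right; apply/IH; exists i; split => //; lia.
Qed.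

Lemma levelset_wpt c a n (b : nat -> M) t : levelset c a (@wpt R M n b t) <->
  exists i, [/\ (i <= n)%N, b i = a & scoord (val t) i.+1 < c < scoord (val t)
    i].
Proof.
have -> : levelset c a (wpt b t) = at_level c a 1 (nz (wlist b (val t))) by [].
rewrite at_level_nz; exact: (at_level_iota c a b (scoord (val t)) n.+1 0).
Qed.

Lemma levelset_open c a : open (levelset c a).
Proof.
have H : wspace_open (levelset c a).
  move=> n b; rewrite (_ : _ @^-1` _ = \bigcup_(i in [set i | (i <= n)%N /\
    b i = a])
     ([set t | scoord (val t) i.+1 < c] `&` [set t | c < scoord (val t) i])).
    apply: bigcup_open => i _; apply: openI; apply: lt_continuous_open;
      do ?[exact: cst_continuous|exact: scoord_val_continuous].
  apply/seteqP; split => [t /levelset_wpt [i [le_i bi /andP[]]]|t [i [le_i bi]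
    [/= h1 h2]]].
    by exists i.
  by apply/levelset_wpt; exists i; rewrite h1 h2.
exact: H.
Qed.

(** The open segments at distinct positions are disjoint, since coordinates decrease. *)
Lemma levelset_uniq c a b e : levelset c a e -> levelset c b e -> a = b.
Proof.
have [n [w [t ->]]] := wpt_surj e.
move=> /levelset_wpt [i [_ <- /andP[i1 i2]]] /levelset_wpt
  [j [_ <- /andP[j1 j2]]].
have ht := set_valP t; have [ij|ji|->//] := ltngtP i j.
  by have := lt_trans (lt_le_trans j2 (scoord_le ht ij)) i1; rewrite ltxx.
by have := lt_trans (lt_le_trans i2 (scoord_le ht ji)) j1; rewrite ltxx.
Qed.

(** The coordinates fall from 1 to 0, so some segment has positive length; its midpoint serves as
    the level. *)
Lemma levelset_cover e : exists c a, levelset c a e.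
Proof.
have [n [w [t ->]]] := wpt_surj e; have ht := set_valP t.
suff [i [le_i hi]] : exists i, (i <= n)%N /\
  scoord (val t) i.+1 < scoord (val t) i.
  exists ((scoord (val t) i.+1 + scoord (val t) i) / 2), (w i).
  apply/levelset_wpt; exists i; split=> //; move: hi; set p := scoord _ _;
    set q := scoord _ _; lra.
apply: contrapT => H.
have E i : (i <= n.+1)%N -> scoord (val t) i = 1.
  elim: i => [//|i IH] le_i; rewrite -IH; last by lia.
  apply/le_anti; rewrite ht //= leNgt; apply/negP => lt.
  by apply: H; exists i.
by have := E n.+1 (leqnn _); rewrite scoord_out // => /eqP;
  rewrite eq_sym oner_eq0.
Qed.

End Levels.

Lemma levelset_wmap (R : realType) (M M' : finType) (h : M -> M') c a (e :
  wspace R M) :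
  levelset c a e -> levelset c (h a) (wmap h e).
Proof.
have [n [w [t ->]]] := wpt_surj e => /levelset_wpt [i [le_i <- hi]].
by rewrite wmap_wpt; apply/levelset_wpt; exists i.
Qed.

(** * The covering of the classifying space by words *)

Section Groupoid.
Variable G : finGroupoid.

Lemma compgK (x y z : G) (h : hom y z) (g : hom x y) : invg h \og (h \og g) = g.
Proof. by rewrite compgA compVg comp1g. Qed.

Lemma compgKV (x y z : G) (h : hom x y) (g : hom x z) : g \og invg h \og h = g.
Proof. by rewrite -compgA compVg compg1. Qed.

Lemma compVKg (x y z : G) (h : hom y z) (g : hom x z) :
  h \og (invg h \og g) = g.
Proof. by rewrite compgA compgV comp1g. Qed.

Lemma compgI (x y z : G) (h : hom y z) (g g' : hom x y) :
  h \og g = h \og g' -> g = g'.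
Proof. by move=> E; rewrite -(compgK h g) E compgK. Qed.

Lemma invg_uniq (x y : G) (h : hom x y) (g : hom y x) :
  g \og h = idg x -> g = invg h.
Proof. by move=> E; rewrite -[RHS]comp1g -E -compgA compgV compg1. Qed.

Lemma invg_comp (x y z : G) (h : hom y z) (g : hom x y) :
  invg (h \og g) = invg g \og invg h.
Proof.
by apply/esym/invg_uniq;
  rewrite compgA -(compgA _ (invg h)) compVg compg1 compVg.
Qed.

Definition star (x : G) : finType := {y : G & hom x y}.

Definition translate (x' x : G) (h : hom x' x) (f : star x) : star x' :=
  Tagged (hom x') (tagged f \og h).

Lemma translate1 x f : translate (idg x) f = f.
Proof. by case: f => y f; rewrite /translate /= compg1. Qed.

Lemma translateM (x'' x' x : G) (h : hom x' x) (h' : hom x'' x') f :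
  translate h' (translate h f) = translate (h \og h') f.
Proof. by rewrite /translate /= compgA. Qed.

Lemma translateK (x' x : G) (h : hom x' x) f :
  translate (invg h) (translate h f) = f.
Proof. by rewrite translateM compgV translate1. Qed.

Lemma translate_inj (x' x : G) (h h' : hom x' x) f :
  translate h f = translate h' f -> h = h'.
Proof.
move=> /eqP; rewrite eq_Tagged /= => /eqP; exact: compgI.
Qed.

Lemma star_translate (x x' : G) (f : star x) (f' : star x') :
  tag f = tag f' -> exists h : hom x' x, f' = translate h f.
Proof.
case: f f' => y f [y' f'] /= yy'; subst y'.
by exists (invg f \og f'); rewrite /translate /= compVKg.
Qed.

(* Letters [a 0, ..., a n] with common source [x] stand for the string of their
   successive quotients;
     it does not change when all letters are precomposed with
   the same arrow, and its faces are obtained by deleting letters. *)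
Fixpoint word_string (x : G) (n : nat) (a : nat -> star x) :
  string n (tag (a 0%N)) :=
  match n return string n (tag (a 0%N)) with
  | 0 => tt
  | m.+1 => existT _ (tag (a 1%N)) (tagged (a 1%N) \og invg (tagged (a 0%N)),
                       word_string m (fun i => a i.+1))
  end.

Definition word_simplex (x : G) (n : nat) (a : nat -> star x) : nsimplex G n :=
  existT _ (tag (a 0%N)) (word_string n a).

Section Framed.
Variable x : G.

(** The type of [word_string n a] depends on [a 0]. Pairing a string with its first letter allows
    equalities without transport, and retains the letter that [word_simplex] forgets. *)
Let fstring (n : nat) : Type := {f : star x & string n (tag f)}.

Let fcons (n : nat) (f : star x) (p : fstring n) : fstring n.+1 :=
  existT (fun f => string n.+1 (tag f)) f
    (existT _ (tag (tag p)) (tagged (tag p) \og invg (tagged f), tagged p)).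

Let fword (n : nat) (a : nat -> star x) : fstring n :=
  existT (fun f => string n (tag f)) (a 0%N) (word_string n a).

Let unframe (n : nat) (p : fstring n) : nsimplex G n :=
  existT _ (tag (tag p)) (tagged p).

Lemma fwordS n a : fword n.+1 a = fcons (a 0%N) (fword n (fun i => a i.+1)).
Proof. by []. Qed.

Lemma fword_ext n (a b : nat -> star x) :
  (forall i, (i <= n)%N -> a i = b i) -> fword n a = fword n b.
Proof.
elim: n a b => [|n IH] a b ab; first by rewrite /fword /= (ab 0%N).
by rewrite !fwordS (ab 0%N) // (IH _ (fun i => b i.+1)) // => i le_i; exact: ab.
Qed.

Lemma word_simplex_ext n (a b : nat -> star x) :
  (forall i, (i <= n)%N -> a i = b i) -> word_simplex n a = word_simplex n b.
Proof. by move=> /fword_ext /(congr1 (@unframe n)). Qed.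

(** Quotients telescope: composing two adjacent ones skips the letter between them. *)
Lemma inner_face_word n j (a : nat -> star x) :
  existT (fun f => string n (tag f)) (a 0%N) (inner_face j (word_string n.+1 a))
    =
  fword n (a \o bump j.+1).
Proof.
elim: n j a => [|n IH] [|j] a //.
  by rewrite /fword /= compgA compgKV.
rewrite fwordS [X in fcons _ X](_ : _ = fword n ((fun i =>
  a i.+1) \o bump j.+1)).
  by rewrite -IH.
by apply: fword_ext => i _ /=; rewrite /bump addnS.
Qed.

Lemma face_word n i (a : nat -> star x) :
  face i (word_simplex n.+1 a) = word_simplex n (a \o bump i).
Proof.
case: i => [//|j].
exact: (congr1 (@unframe n) (inner_face_word n j a)).
Qed.

(** Inverse to [word_string] once the first letter [f] is chosen: the letters are the partial
    composites of the string with [f]. *)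
Fixpoint read_word (n : nat) : forall y : G, hom x y -> string n y -> nat ->
  star x :=
  match n return forall y : G, hom x y -> string n y -> nat -> star x with
  | 0 => fun y f _ _ => Tagged (hom x) f
  | m.+1 => fun y f s i =>
    if i is j.+1 then let: existT z (g, s') := s in read_word (g \og f) s' j
    else Tagged (hom x) f
  end.

Lemma read_word0 n y (f : hom x y) (s : string n y) :
  read_word f s 0 = Tagged (hom x) f.
Proof. by case: n s. Qed.

Lemma fword_read n y (f : hom x y) (s : string n y) :
  fword n (read_word f s) = existT (fun f => string n (tag f)) (Tagged (hom x)
    f) s.
Proof.
elim: n y f s => [|n IH] y f; first by case.
case=> z [g s]; rewrite fwordS read_word0 IH /fcons /=.
by rewrite -compgA compgV compg1.
Qed.

Lemma word_simplex_read n y (f : hom x y) (s : string n y) :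
  word_simplex n (read_word f s) = existT _ y s.
Proof. exact: (congr1 (@unframe n) (fword_read f s)). Qed.

Lemma read_wordK n (a : nat -> star x) i : (i <= n)%N ->
  read_word (tagged (a 0%N)) (word_string n a) i = a i.
Proof.
elim: n a i => [|n IH] a [|i] //= le_i; do ?by case: (a 0%N).
by rewrite compgKV (IH (fun i => a i.+1)).
Qed.

Lemma word_simplex_inj0 n (a b : nat -> star x) : a 0%N = b 0%N ->
  word_simplex n a = word_simplex n b -> forall i, (i <= n)%N -> a i = b i.
Proof.
move=> ab0 ab i le_i.
have aux (f f' : star x) (u : string n (tag f)) (v : string n (tag f')) :
  f = f' ->
    existT (@string G n) (tag f) u = existT (@string G n) (tag f') v ->
    existT (fun f => string n (tag f)) f u = existT (fun f => string n (tag f))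
      f' v.
  by move=> ff'; subst f' => /eqP; rewrite eq_Tagged /= => /eqP ->.
have /(congr1 (fun p : fstring n => read_word (tagged (tag p)) (tagged p) i)) :=
  aux _ _ _ _ ab0 ab.
by rewrite /= !read_wordK.
Qed.

End Framed.

Lemma word_string_translate x x' (h : hom x' x) n (a : nat -> star x) :
  word_string n (fun i => translate h (a i)) = word_string n a.
Proof.
elim: n a => [//|n IH] a /=; rewrite (IH (fun i => a i.+1)).
by rewrite invg_comp !compgA -(compgA _ h) compgV compg1.
Qed.

Lemma word_simplex_translate x x' (h : hom x' x) n (a : nat -> star x) :
  word_simplex n (translate h \o a) = word_simplex n a.
Proof. by rewrite /word_simplex (word_string_translate h n a). Qed.

(** The first letters have the same target, so they differ by an arrow [h]; the first letter and the
    quotients determine all the others. *)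
Lemma word_simplex_inj x x' n (a : nat -> star x) (b : nat -> star x') :
  word_simplex n a = word_simplex n b ->
  exists h : hom x' x, forall i, (i <= n)%N -> b i = translate h (a i).
Proof.
move=> ab; have [h hE] := star_translate (congr1 (@tag _ _) ab).
exists h => i le_i; apply/esym.
apply: (@word_simplex_inj0 x' n (translate h \o a) b) => //.
by rewrite word_simplex_translate.
Qed.

End Groupoid.

(** * The projection from words to the classifying space *)

Section Projection.
Variables (R : realType) (G : finGroupoid).
Local Notation BG := (classifying_space R G).
Local Notation simplex n := (set_type (std_simplex R n)).

Definition bpt (x : G) n (a : nat -> star x) (t : simplex n) : BG :=
  \pi_BG (point_of (word_simplex n a) (set_valP t)).

Lemma point_of_val n (s : nsimplex G n) (t : simplex n) :
  point_of s (set_valP t) =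
  existT (fun s => set_type (std_simplex R (tag s))) (existT _ n s) t :>
    points R G.
Proof. by rewrite /point_of; congr existT; exact: val_inj. Qed.

Lemma bpt_ext (x : G) n (a b : nat -> star x) (t u : simplex n) :
  (forall i, (i <= n)%N -> a i = b i) -> val t = val u -> bpt a t = bpt b u.
Proof.
by move=> ab tu; congr \pi_BG; apply: point_ofE => //; exact: word_simplex_ext.
Qed.

Lemma bpt_face (x : G) n i (a : nat -> star x) (t : simplex n) (u :
  simplex n.+1) :
  (i <= n.+1)%N -> val u = coface i (val t) -> bpt a u = bpt (a \o bump i) t.
Proof. by move=> le_i uE; apply: (pi_glue (i := i)) => //;
  rewrite face_word. Qed.

Lemma bpt_translate (x x' : G) (h : hom x' x) n (a : nat -> star x) (t :
  simplex n) :
  bpt (translate h \o a) t = bpt a t.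
Proof. by rewrite /bpt word_simplex_translate. Qed.

Lemma bpt_continuous (x : G) n (a : nat -> star x) : continuous (@bpt x n a).
Proof.
have -> : @bpt x n a = \pi_BG \o existT
    (fun s : {n : nat & nsimplex G n} => set_type (std_simplex R (tag s)))
    (existT _ n (word_simplex n a)).
  by apply/funext => t; rewrite /bpt point_of_val.
move=> t; apply: continuous_comp; last exact: pi_continuous.
exact: existT_continuous.
Qed.

(** Inverse to [coface i] where the letter [i] has weight 0: one of the equal coordinates [i] and
    [i.+1] is dropped. *)
Definition uncoface n i (t : 'rV[R]_n.+1) : 'rV[R]_n :=
  \row_(j < n) scoord t (if (j.+1 <= i)%N then j.+1 else j.+2).

Lemma scoord_uncoface n i (t : 'rV[R]_n.+1) k : (i <= n.+1)%N ->
  scoord t i = scoord t i.+1 ->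
  scoord (uncoface i t) k = scoord t (if (k <= i)%N then k else k.+1).
Proof.
move=> le_i ti; case: k => [//|k].
have [lt_k|ge_k] := ltnP k n.
  by rewrite (scoord_row (fun j => scoord t (if (j.+1 <= i)%N then j.+1 else
    j.+2))).
rewrite scoord_out ?ltnS //; case: ifP => ki; last by rewrite scoord_out.
(* Here [k = n] and [i = n.+1]: the dropped coordinate is the last one, equal to 0 by the convention
   on [scoord]. *)
have -> : k.+1 = i by lia.
by rewrite ti scoord_out //; lia.
Qed.

Lemma uncoface_simplex n i (t : 'rV[R]_n.+1) : (i <= n.+1)%N ->
  scoord t i = scoord t i.+1 -> std_simplex R n.+1 t ->
  std_simplex R n (uncoface i t).
Proof.
move=> le_i ti ht k _; rewrite !scoord_uncoface //; apply: scoord_le => //.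
by case: ifP; case: ifP => //; lia.
Qed.

Lemma uncofaceK n i (t : 'rV[R]_n.+1) : (i <= n.+1)%N ->
  scoord t i = scoord t i.+1 -> t = coface i (uncoface i t).
Proof.
move=> le_i ti; apply: scoordP => k;
  rewrite scoord_cofaceE // scoord_uncoface //.
have [ki|ik] := leqP k i; first by rewrite ki.
case: ifP => [ki|]; last by case: k ik => //.
have -> : k = i.+1 by lia.
by rewrite -ti.
Qed.

(** Letters of weight 0 are deleted one at a time, with the same effect on [wpt] and [bpt]. In the
    resulting open simplex [nz] removes nothing, so the list determines letters and coordinates. *)
Lemma bpt_reduce (x : G) n (a : nat -> star x) (t : simplex n) :
  exists m b (u : simplex m), [/\ forall i, (i <= m)%N -> weight (val u) i != 0,
    wpt a t = wpt b u & bpt a t = bpt b u].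
Proof.
elim: n a t => [|n IH] a t.
  exists 0%N, a, t; split=> // i; rewrite leqn0 => /eqP ->.
  by rewrite /weight (scoord_out _ (ltnSn 0)) subr0 oner_eq0.
have [H|] := pselect (forall i, (i <= n.+1)%N -> weight (val t) i != 0).
  by exists n.+1, a, t.
move=> /existsNP [i /not_implyP [le_i /negP/negPn]].
rewrite /weight subr_eq0 => /eqP ti; have ht := set_valP t.
pose t' := mksimplex (uncoface_simplex le_i ti ht).
have tE : val t = coface i (val t') by exact: uncofaceK.
have [m [b [u [u0 wE bE]]]] := IH (a \o bump i) t'.
by exists m, b, u; split=> //; rewrite -?wE -?bE;
  [exact: wpt_coface|exact: bpt_face].
Qed.

Lemma wlist_inj (M : finType) n m (a b : nat -> M) (t : 'rV[R]_n) (u : 'rV[R]_m)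
  :
  wlist a t = wlist b u ->
  [/\ n = m, forall i, (i <= n)%N -> a i = b i & scoord t =1 scoord u].
Proof.
move=> E; have nm : n = m by have := congr1 size E; rewrite !size_mkseq => -[].
subst m; split=> // [i le_i|k].
  have := congr1 (fun s => nth (a i, 0) s i) E.
  by rewrite /wlist !nth_mkseq // => -[].
have [le_k|lt_k] := leqP k n; last by rewrite !scoord_out.
elim: k le_k => [//|k IH] lt_k.
have := congr1 (fun s => nth (a k, 0) s k) E.
rewrite /wlist !nth_mkseq ?ltnS ?(ltnW lt_k) // => -[_].
by rewrite /weight IH ?(ltnW lt_k) // => /addrI /oppr_inj.
Qed.

Lemma bpt_wpt (x : G) n m (a b : nat -> star x) (t : simplex n) (u : simplex m)
  :
  wpt a t = wpt b u -> bpt a t = bpt b u.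
Proof.
have [n' [a' [t' [t0 -> ->]]]] := bpt_reduce a t.
have [m' [b' [u' [u0 -> ->]]]] := bpt_reduce b u.
have nzE k (c : nat -> star x) (v : simplex k) :
    (forall i, (i <= k)%N -> weight (val v) i != 0) ->
    val (wpt c v) = wlist c (val v).
  move=> v0; rewrite val_wpt; apply/all_filterP/allP => p /mapP [i].
  by rewrite mem_iota => /andP[_ le_i] ->; exact: v0.
move=> /(congr1 val); rewrite !nzE // => /wlist_inj [nm ab tu].
by subst m'; apply: bpt_ext => //; exact: scoordP.
Qed.

Section Framed.
Variable x : G.

Definition wproj (e : wspace R (star x)) : BG :=
  let n := projT1 (cid (wpt_surj e)) in
  let H := projT2 (cid (wpt_surj e)) in
  let a := projT1 (cid H) in
  let t := projT1 (cid (projT2 (cid H))) in bpt a t.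

Lemma wproj_wpt n (a : nat -> star x) (t : simplex n) :
  wproj (wpt a t) = bpt a t.
Proof. by apply/esym/bpt_wpt;
  exact: (projT2 (cid (projT2 (cid (projT2 (cid (wpt_surj (wpt a t)))))))). Qed.

Lemma wproj_continuous : continuous wproj.
Proof.
apply: wspace_continuous => n a.
rewrite (_ : _ \o _ = @bpt x n a); first exact: bpt_continuous.
by apply/funext => t; exact: wproj_wpt.
Qed.

End Framed.

Lemma wproj_translate (x x' : G) (h : hom x' x) (e : wspace R (star x)) :
  wproj (wmap (translate h) e) = wproj e.
Proof.
by have [n [a [t ->]]] := wpt_surj e; rewrite wmap_wpt !wproj_wpt bpt_translate.
Qed.

Lemma points_word (p : points R G) : exists (x : G) n (a : nat -> star x) (t :
  simplex n),
  p = point_of (word_simplex n a) (set_valP t).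
Proof.
case: p => -[n [x s]] t; exists x, n, (read_word (idg x) s), t.
by rewrite point_of_val word_simplex_read.
Qed.

Lemma wproj_surj (q : BG) : exists (x : G) (e : wspace R (star x)), q = wproj e.
Proof.
rewrite -[q]reprK; have [x [n [a [t ->]]]] := points_word (repr q).
by exists x, (wpt a t); rewrite wproj_wpt.
Qed.

(** Every simplex of [BG] is the image of a simplex of words, read off with an identity as first
    letter; so the maps [wproj] are jointly a quotient map. *)
Lemma wproj_open (U : set BG) :
  (forall x : G, open (@wproj x @^-1` U)) -> open U.
Proof.
move=> oU; apply/sigT_openP => -[n [x s]] /=.
rewrite (_ : _ @^-1` _ = @wpt R _ n (read_word (idg x) s) @^-1` (@wproj x @^-1`
  U)).
  exact: oU.
apply/seteqP; split => t; rewrite /preimage /= wproj_wpt /bpt;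
  by rewrite point_of_val word_simplex_read.
Qed.

Lemma wproj_to_continuous (Z : topologicalType) (f : BG -> Z) :
  (forall x : G, continuous (f \o @wproj x)) -> continuous f.
Proof.
move=> cf; apply/continuousP => U oU; apply: wproj_open => x.
by rewrite -comp_preimage; move/continuousP: (cf x); exact.
Qed.

Lemma point_of_inj n m (s : nsimplex G n) (s' : nsimplex G m)
    (t : simplex n) (u : simplex m) :
  point_of s (set_valP t) = point_of s' (set_valP u) :> points R G ->
  exists e : n = m, eq_rect n (nsimplex G) s m e = s' /\
    scoord (val t) =1 scoord (val u).
Proof.
rewrite !point_of_val => E.
have snm : existT (nsimplex G) n s = existT (nsimplex G) m s' by exact:
  (congr1 (@tag _ _) E).
have nm : n = m by exact: (congr1 (@tag _ _) snm).
subst m; exists erefl.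
have ss' : s = s' by apply/eqP; move/eqP: snm; rewrite eq_Tagged.
split=> //; subst s'; move/eqP: E; rewrite eq_Tagged => /eqP /= ->.
by [].
Qed.

(** All words representing [p] and [q] are allowed, so that the induction can pass through
    intermediate points. Two words for the same point already differ by an arrow ([same]), a gluing
    is the deletion of a letter of weight 0, and symmetry and transitivity invert and compose
    arrows. *)
Lemma glued_translate (p q : points R G) (x x' : G) n m
    (a : nat -> star x) (b : nat -> star x') (t : simplex n) (u : simplex m) :
  glued p q -> p = point_of (word_simplex n a) (set_valP t) ->
  q = point_of (word_simplex m b) (set_valP u) ->
  exists h : hom x' x, wpt b u = wmap (translate h) (wpt a t).
Proof.
have same (p' : points R G) (y y' : G) k l (c : nat -> star y) (d : nat ->
  star y')
    (v : simplex k) (w : simplex l) :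
    p' = point_of (word_simplex k c) (set_valP v) ->
    p' = point_of (word_simplex l d) (set_valP w) ->
    exists h : hom y' y, wpt d w = wmap (translate h) (wpt c v).
  move=> -> /point_of_inj [e]; subst l => /= -[/word_simplex_inj [h hE] vw].
  exists h; rewrite wmap_wpt; apply: wpt_ext => [i le_i|]; first exact: hE.
  by apply: scoordP => i; rewrite vw.
move=> /asboolP pq; elim: pq x x' n m a b t u => {p q}.
- move=> p q [n' i s t' le_i ht'] x x' n m a b t u pE qE.
  case: s pE qE => y s.
  rewrite -(word_simplex_read (idg y) s); set c := read_word _ _.
  have -> : coface_simplex le_i ht' = set_valP (mksimplex (coface_simplex le_i
    ht')).
    exact: Prop_irrelevance.
  have -> : ht' = set_valP (mksimplex ht') by exact: Prop_irrelevance.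
  rewrite face_word => pE qE.
  have [h hE] := same _ _ _ _ _ c a
    (mksimplex (coface_simplex le_i (set_valP (mksimplex ht')))) t erefl pE.
  have [k kE] := same _ _ _ _ _ (c \o bump i) b (mksimplex ht') u erefl qE.
  exists (invg h \og k); rewrite kE hE.
  rewrite (wpt_coface (i := i) c (t := mksimplex ht')) // wmap_comp.
  apply: eq_wmap => f; rewrite /= translateM; congr translate.
  by rewrite compVKg.
- by move=> p x x' n m a b t u; exact: same.
- move=> p q _ IH x x' n m a b t u qE pE.
  have [h hE] := IH _ _ _ _ _ _ _ _ pE qE.
  exists (invg h); rewrite hE wmap_comp [RHS]wmap_id // => f.
  exact: translateK.
move=> p q r _ IH1 _ IH2 x x' n m a b t u pE rE.
have [y [k [c [v qE]]]] := points_word q.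
have [h hE] := IH1 _ _ _ _ _ _ _ _ pE qE.
have [h' hE'] := IH2 _ _ _ _ _ _ _ _ qE rE.
exists (h \og h'); rewrite hE' hE wmap_comp; apply: eq_wmap => f.
exact: translateM.
Qed.

Lemma wproj_eq (x x' : G) (e : wspace R (star x)) (e' : wspace R (star x')) :
  wproj e = wproj e' -> exists h : hom x' x, e' = wmap (translate h) e.
Proof.
have [n [a [t ->]]] := wpt_surj e; have [m [b [u ->]]] := wpt_surj e'.
rewrite !wproj_wpt => /eqmodP H; exact: glued_translate H erefl erefl.
Qed.

Lemma wtranslate_inj (x x' : G) (h h' : hom x' x) (e : wspace R (star x)) :
  wmap (translate h) e = wmap (translate h') e -> h = h'.
Proof.
have [c [a Ve]] := levelset_cover e => E.
apply: (@translate_inj _ _ _ _ _ a);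
  apply: (levelset_uniq (levelset_wmap _ Ve)).
by rewrite E; exact: levelset_wmap.
Qed.

Lemma wtranslateM (x x' x'' : G) (h : hom x' x) (h' : hom x'' x') (e :
  wspace R (star x)) :
  wmap (translate h') (wmap (translate h) e) = wmap (translate (h \og h')) e.
Proof. by rewrite wmap_comp; apply: eq_wmap => f; exact: translateM. Qed.

(** The preimage of the image of [U] in the words out of [x'] is the union of the preimages of [U]
    under translations. *)
Lemma wproj_open_map (x : G) (U : set (wspace R (star x))) :
  open U -> open (@wproj x @` U).
Proof.
move=> oU; apply: wproj_open => x'.
rewrite (_ : _ @^-1` _ = \bigcup_(h in [set: hom x x'])
    (wmap (translate h) @^-1` U)).
  apply: bigcup_open => h _; move: U oU; apply/continuousP.
  exact: wmap_continuous.
apply/seteqP; split => [e' [e Ue /esym/wproj_eq [h hE]]|e' [h _ Ue]].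
  by exists h => //; rewrite /preimage /= -hE.
by exists (wmap (translate h) e') => //; rewrite wproj_translate.
Qed.

End Projection.

(** * The Parmesan map on words *)

Section Loops.
Variables (R : realType) (G : finGroupoid).
Local Notation L := (loop_groupoid G).
Local Notation BG := (classifying_space R G).
Local Notation BL := (classifying_space R L).
Local Notation simplex n := (set_type (std_simplex R n)).

Section Framed.
Variables (x : G) (c : hom x x).

Definition loop_at : L := Tagged (fun y : G => hom y y) c.

Definition loop_arrow (y : G) (f : hom x y) :
  loop_hom loop_at (Tagged (fun y : G => hom y y) (conjg f c)) :=
  Sub f (eqxx (conjg f c)).

(** An arrow out of [c] in the loop groupoid is just an arrow out of [x], its target being forced;
    so words of [G] also parametrize [BL]. *)
Definition loop_star (f : star x) : star loop_at :=
  existT (fun b : L => hom loop_at b)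
    (Tagged (fun y : G => hom y y) (conjg (tagged f) c))
    (loop_arrow (tagged f)).

Definition base_star (g : star loop_at) : star x :=
  existT (fun y : G => hom x y) (tag (tag g)) (val (tagged g)).

Lemma base_starK g : loop_star (base_star g) = g.
Proof.
suff H (y : G) (d : hom y y) (f : hom x y) (fE : conjg f c == d) :
    loop_star (existT _ y f) = existT (fun b : L => hom loop_at b)
      (Tagged (fun y : G => hom y y) d) 
      (Sub f fE : loop_hom loop_at (Tagged (fun y : G => hom y y) d)).
  by case: g => -[y d] [f fE]; exact: H.
by have dE := eqP fE; subst d; congr existT; exact: val_inj.
Qed.

Lemma forget_word n (a : nat -> star x) :
  forget (word_string n (loop_star \o a)) = word_string n a.
Proof. by elim: n a => [//|n IH] a /=; rewrite (IH (fun i => a i.+1)). Qed.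

Definition loop_proj (e : wspace R (star x)) : BL := wproj (wmap loop_star e).

Lemma loop_proj_continuous : continuous loop_proj.
Proof.
move=> e; apply: (continuous_comp (f := wmap loop_star)).
  exact: wmap_continuous.
exact: wproj_continuous.
Qed.

(** On letters, inserting the loop repeats the letter [m] and translates everything from its second
    copy on by [c]. The one new quotient is the conjugate of [c] by [a m]. *)
Definition insert_word (m : nat) (a : nat -> star x) (i : nat) : star x :=
  if (i <= m)%N then a i else translate c (a i.-1).

Lemma insert_loop_word n m (a : nat -> star x) : (m <= n)%N ->
  existT (fun f : star x => string n.+1 (tag f)) (a 0%N)
    (insert_loop m (conjg (tagged (a 0%N)) c) (word_string n a)) =
  existT (fun f : star x => string n.+1 (tag f)) (insert_word m a 0%N)
    (word_string n.+1 (insert_word m a)).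
Proof.
elim: n m a => [|n IH] [|m] a // le_m.
  have -> : word_string n.+2 (insert_word 0 a) =
    existT _ (tag (a 0%N)) (conjg (tagged (a 0%N)) c,
       word_string n.+1 (fun i => translate c (a i))) :> string n.+2 (tag
         (a 0%N)).
    by [].
  by rewrite (word_string_translate c n.+1 a).
have E : insert_word m (fun i => a i.+1) = (fun i => insert_word m.+1 a i.+1).
  by apply/funext => -[|i].
pose next (p : {f : star x & string n.+1 (tag f)}) :=
  existT (fun f : star x => string n.+2 (tag f)) (a 0%N)
    (existT _ (tag (tag p)) (tagged (tag p) \og invg (tagged (a 0%N)),
      tagged p)).
have := congr1 next (IH m (fun i => a i.+1) le_m).
rewrite E /next /= -conjg_comp compgKV; exact.
Qed.

Lemma par_simplex_word n m (a : nat -> star x) : (m <= n)%N ->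
  par_simplex m (word_simplex n (loop_star \o a)) =
  word_simplex n.+1 (insert_word m a).
Proof.
move=> le_m.
have := congr1 (fun p : {f : star x & string n.+1 (tag f)} =>
  existT _ (tag (tag p)) (tagged p) : nsimplex G n.+1) (insert_loop_word a
    le_m).
by rewrite /= -(forget_word n a).
Qed.

(** Letters after [m] have no length above [u], and letters before [m] none below. Only the letter
    [m] can be cut in two. *)
Lemma insert_split n m (a : nat -> star x) (t : 'rV[R]_n) (u : R) :
  std_simplex R n t -> (m <= n)%N -> scoord t m.+1 <= u <= scoord t m ->
  nz (wlist (insert_word m a) (insert_coord m u t)) =
  nz (upper u 1 (wlist a t) ++ relabel (translate c) (lower u 1 (wlist a t))).
Proof.
move=> ht le_m /andP[u1 u2]; rewrite upper_wlist lower_wlist /relabel.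
have -> : wlist (insert_word m a) (insert_coord m u t) =
  mkseq (fun i => (insert_word m a i, weight (insert_coord m u t) i))
    (m.+1 + (n.+1 - m)) by congr mkseq; lia.
set F := (fun i => (a i, Num.max _ _ - _));
  set F' := (fun i => (a i, Num.min _ _ - _)).
have -> : mkseq F n.+1 = mkseq F (m.+1 + (n - m)) by congr mkseq; lia.
have -> : mkseq F' n.+1 = mkseq F' (m + (n.+1 - m)) by congr mkseq; lia.
have le_t i j : (i <= j)%N -> scoord t j <= scoord t i by exact: scoord_le.
rewrite !mkseq_cat map_cat !nz_cat -catA; congr (_ ++ _).
  congr nz; apply/eq_in_map => i; rewrite mem_iota add0n ltnS => /andP[_ im].
  rewrite /F /insert_word im /weight !scoord_insertE // im; congr pair.
  have [im'|mi] := ltnP i m.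
    by rewrite !max_l // (le_trans u2) // le_t // ltnW.
  have -> : i = m by lia.
  by rewrite eqxx max_l // max_r.
have zero (g : nat -> star x) (h : nat -> R) k :
    (forall i, (i < k)%N -> h i = 0) -> nz [seq (g i, h i) | i <- iota 0 k] =
      [::].
  move=> h0; rewrite /nz -[RHS](filter_pred0 [seq (g i, h i) | i <- iota 0 k]).
  apply/eq_in_filter => p /mapP [i]; rewrite mem_iota => /andP[_ ik] -> /=.
  by rewrite h0 ?eqxx.
rewrite [nz (mkseq _ (n - m))](_ : _ = [::]); last first.
  apply: zero => i _; rewrite /F /= !max_r ?subrr // (le_trans _ u1) // le_t //;
    lia.
rewrite [nz [seq _ | _ <- mkseq _ m]](_ : _ = [::]); last first.
  rewrite /mkseq -map_comp; apply: zero => i im.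
  by rewrite /F' /= !min_l ?subrr // (le_trans u2) // le_t // ltnW.
rewrite !cat0s; congr nz; rewrite /mkseq -map_comp; apply/eq_map => i /=.
have E1 : (m.+1 + i <= m)%N = false by lia.
have E2 : ((m.+1 + i).+1 <= m)%N = false by lia.
have E3 : ((m.+1 + i).+1 == m.+1)%N = false by lia.
rewrite /insert_word /weight !scoord_insertE // E1 E2 E3 /F' /=.
congr (translate c (a _), _ - _).
  (* The second copy of the letter [m] starts at the inserted coordinate [u]. *)
  have [->|i0] := eqVneq i 0%N; first by rewrite !addn0 eqxx min_l.
  rewrite ifF; last by lia.
  by rewrite min_r // (le_trans _ u1) // le_t //; lia.
by rewrite min_r // (le_trans _ u1) // le_t //; lia.
Qed.

Lemma Par_loop_proj (e : wspace R (star x)) (u : unit_interval R) :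
  Par (loop_proj e) (\pi_(circle R) u) = wproj (wsplit (translate c) e u).
Proof.
have [n [a [t ->]]] := wpt_surj e; have ht := set_valP t.
have [[m /= lt_m] hm] := par_index_subproof (val t) (unit_intervalP u).
have le_m : (m <= n)%N by [].
rewrite /loop_proj wmap_wpt wproj_wpt (ParE _ _ le_m hm) par_simplex_word //.
pose v := mksimplex (insert_coord_simplex le_m hm ht).
have -> : wsplit (translate c) (wpt a t) u = wpt (insert_word m a) v.
  by apply: val_inj; rewrite val_wsplit !val_wpt split_list_nz /split_list
    -(insert_split a ht le_m hm).
by rewrite wproj_wpt; congr \pi_BG; exact: point_ofE.
Qed.

End Framed.

(** [h] is also an arrow [k] of the loop groupoid, from the conjugate loop to [c]; this is
    [wproj_translate] for [k]. *)
Lemma loop_proj_translate (x x' : G) (h : hom x' x) (c : hom x x)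
    (e : wspace R (star x)) :
  loop_proj (invg h \og c \og h) (wmap (translate h) e) = loop_proj c e.
Proof.
have hE : conjg h (invg h \og c \og h) == c.
  by apply/eqP; rewrite /conjg !compgA compgV comp1g -compgA compgV compg1.
pose k : @hom L (loop_at (invg h \og c \og h)) (loop_at c) := Sub h hE.
rewrite /loop_proj -(wproj_translate k) !wmap_comp; congr wproj.
apply: eq_wmap => f /=.
rewrite -[RHS]base_starK; congr loop_star.
Qed.

Lemma loop_proj_surj (p : BL) : exists (x : G) (c : hom x x) (e :
  wspace R (star x)),
  p = loop_proj c e.
Proof.
have [[x c] [e ->]] := wproj_surj p; exists x, c, (wmap (@base_star x c) e).
by rewrite /loop_proj wmap_comp wmap_id // => f; exact: base_starK.
Qed.

Lemma loop_space_to_continuous (Z : topologicalType) (f : BL -> Z) :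
  (forall (x : G) (c : hom x x), continuous (f \o loop_proj c)) -> continuous f.
Proof.
move=> cf; apply: wproj_to_continuous => -[x c].
have -> : f \o @wproj R L (Tagged (fun y : G => hom y y) c) =
    (f \o loop_proj c) \o wmap (@base_star x c).
  apply/funext => e /=; rewrite /loop_proj wmap_comp wmap_id // => g.
  exact: base_starK.
move=> e; apply: continuous_comp; first exact: wmap_continuous.
exact: cf.
Qed.

End Loops.

(** * Free loops *)

Section Circle.
Variable R : realType.
Local Notation I := (unit_interval R).

Lemma circle_piE (u v : I) :
  \pi_(circle R) u = \pi_(circle R) v <-> u = v \/ is_end u /\ is_end v.
Proof.
split=> [/eqmodP /predU1P[->|/andP[]]|[->|[eu ev]]] //; [by left|by right|].
by apply/eqmodP; rewrite /= /circle_rel eu ev orbT.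
Qed.

Lemma ends_closed : closed [set u : I | is_end u].
Proof.
rewrite (_ : mkset _ = [set unit0 R] `|` [set unit1 R]).
  by apply: closedU; apply: accessible_closed_set1; apply: hausdorff_accessible;
    exact: unit_interval_hausdorff.
apply/seteqP; split => u; rewrite /is_end /=; first by case/orP => /eqP;
  [left|right].
by case=> ->; rewrite eqxx ?orbT.
Qed.

Lemma fiber_compact (u : I) : compact [set v | \pi_(circle R) v = \pi_(circle R)
  u].
Proof.
have [eu|eu] := boolP (is_end u).
  rewrite (_ : mkset _ = [set v | is_end v]).
    by apply: (subclosed_compact ends_closed (@unit_interval_compact R)) => ?.
  apply/seteqP; split => v /=; first by case/circle_piE => [->|[]].
  by move=> ev; apply/circle_piE; right.
rewrite (_ : mkset _ = [set u]); first exact: compact_set1.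
apply/seteqP; split => v /= => [/circle_piE [//|[_]]|-> //].
by rewrite (negbTE eu).
Qed.

(** The product of a quotient map with an identity need not be a quotient map. Here the fibers are
    compact, so the tube lemma gives a box around the fiber, which is then made saturated. *)
Lemma circle_prod_continuous (Y Z : topologicalType) (h : Y * circle R -> Z) :
  continuous (fun z : Y * I => h (z.1, \pi_(circle R) z.2)) -> continuous h.
Proof.
move=> ch [y0 th0] O; rewrite nbhsE => -[W [oW Wh] WO].
pose u0 := repr th0; have th0E : \pi_(circle R) u0 = th0 by exact: reprK.
pose W' : set (Y * I) := (fun z : Y * I => h (z.1, \pi_(circle R) z.2)) @^-1` W.
have oW' : open W' by move/continuousP: ch; apply.
have [|U [V [oU oV y0U fV UVW]]] := @tube _ _ [set y0]
    [set v | \pi_(circle R) v = \pi_(circle R) u0] W' (@compact_set1 _ y0)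
    (@fiber_compact u0) oW'.
  by move=> [y v] [/= -> vE]; rewrite /W' /preimage /= vE th0E.
(* If [u0] is an end, [V] already contains both ends; otherwise both are removed. *)
pose V' := V `&` [set v | is_end u0 \/ ~ is_end v].
have V'sat u v : \pi_(circle R) u = \pi_(circle R) v -> V' u -> V' v.
  move=> /circle_piE [<- //|[eu ev]] [Vu [eu0|//]]; split; last by left.
  by apply: fV; apply/circle_piE; right.
have oV' : open V'.
  apply: openI => //; have [eu0|eu0] := pselect (is_end u0).
    rewrite (_ : mkset _ = setT); first exact: openT.
    by apply/seteqP; split=> // v _; left.
  rewrite (_ : mkset _ = ~` [set v | is_end v]).
    by apply: closed_openC; exact: ends_closed.
  by apply/seteqP; split=> v /= => [[]|]; [|by []|by right].
pose T : set (circle R) := \pi_(circle R) @` V'.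
have oT : open T.
  rewrite /open /= /quotient_open (_ : _ @^-1` _ = V') //.
  apply/seteqP; split => [v [u V'u uv]|v V'v]; first exact: V'sat uv V'u.
  by exists v.
exists (U, T).
  split; apply: open_nbhs_nbhs; split => //; first exact: y0U.
  exists u0 => //; split; first exact: fV.
  by have [|] := pselect (is_end u0); [left|right].
move=> [y th] [/= Uy [v [Vv _] <-]]; apply: WO.
exact: (UVW (y, v)).
Qed.

Lemma loop_continuous (Y X : topologicalType) (F : Y * I -> X)
    (f : Y -> free_loop_space R X) : continuous F ->
  (forall y u, f y (\pi_(circle R) u) = F (y, u)) -> continuous f.
Proof.
move=> cF fF; apply: continuous_comp_initial.
have ch : continuous (fun z : Y * circle R => (f z.1 : circle R -> X) z.2).
  apply: circle_prod_continuous => /=.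
  rewrite (_ : (fun z => _) = F) //.
  by apply/funext => -[y u] /=; rewrite fF.
exact: (continuous_curry_fun ch).
Qed.

Definition loop_eval (X : topologicalType) (z : free_loop_space R X * I) : X :=
  z.1 (\pi_(circle R) z.2).

(** A compact neighborhood of [u0] in the interval is pushed forward to a compact subset of the
    circle, which defines a compact-open neighborhood of [l0]. *)
Lemma loop_eval_continuous (X : topologicalType) : continuous (@loop_eval X).
Proof.
move=> [l0 u0] O; rewrite nbhsE => -[W [oW Wl] WO].
have cl : continuous ((l0 : circle R -> X) \o \pi_(circle R)).
  by move=> u; apply: continuous_comp; [exact: pi_continuous|exact: cts_fun].
have nA : nbhs u0 (((l0 : circle R -> X) \o \pi_(circle R)) @^-1` W).
  by apply: cl; apply: open_nbhs_nbhs.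
have [N nN NA] := compact_regular (@unit_interval_hausdorff R)
  (@unit_interval_compact R) (@filterT _ _ _) nA.
have cK : compact (\pi_(circle R) @` closure N).
  apply: continuous_compact; first by apply: continuous_subspaceT;
    exact: pi_continuous.
  by apply: (subclosed_compact (@closed_closure _ N) (@unit_interval_compact R))
    => ?.
exists ([set l : free_loop_space R X | (l : circle R -> X) @` (\pi_(circle R) @`
  closure N) `<=` W], N).
  split=> //=; apply: open_nbhs_nbhs; split.
    by exists [set g : {compact-open, circle R -> X} | g @` (\pi_(circle R) @`
      closure N) `<=` W] => //;
       exact: compact_open_open.
  by move=> _ [_ [u Nu <-] <-]; exact: NA.
move=> [l u] [/= lW Nu]; apply: WO; apply: lW; exists (\pi_(circle R) u) => //.
by exists u => //; exact: subset_closure.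
Qed.

Section MakeLoop.
Variables (X : topologicalType) (k : I -> X).
Hypotheses (ck : continuous k) (k01 : k (unit0 R) = k (unit1 R)).

Lemma make_loop_homo : {homo k : u v /
  \pi_(circle R) u == \pi_(circle R) v :> circle R >-> u == v}.
Proof.
move=> u v /eqP/circle_piE [-> //|].
by rewrite /is_end => -[/orP[]/eqP-> /orP[]/eqP->]; rewrite ?k01.
Qed.

Lemma make_loop_continuous : continuous (k \o repr : circle R -> X).
Proof. exact: repr_comp_continuous ck make_loop_homo. Qed.

Definition make_loop : free_loop_space R X := mkcts make_loop_continuous.

Lemma make_loopE u : make_loop (\pi_(circle R) u) = k u.
Proof. by apply/eqP/make_loop_homo; rewrite reprK. Qed.

End MakeLoop.

Lemma loop_ext (X : topologicalType) (l l' : free_loop_space R X) :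
  (forall u, l (\pi_(circle R) u) = l' (\pi_(circle R) u)) -> l = l'.
Proof.
by move=> E; apply/continuousEP => th; rewrite -[th]reprK.
Qed.

(** Extends paths from the interval to all of [R], where lifting and pasting take place. *)
Definition clampI (t : R) : I :=
  exist (fun x => x \in (`[0, 1]%classic : set R)) _
    (in_unit_interval (clampP t (@ler01 R))).

Lemma clampI_continuous : continuous clampI.
Proof. by apply: continuous_comp_initial; exact: clamp_continuous. Qed.

Lemma clampI_val (u : I) : clampI (val u) = u.
Proof. by apply: val_inj; rewrite /= clamp_id //; exact: unit_intervalP. Qed.

(** The hypothesis makes the truth of [P] locally constant, and the interval is connected. *)
Lemma interval_induction (P : R -> Prop) :
  (forall s, 0 <= s <= 1 -> exists2 e : R, 0 < e & forall r r', 0 <= r <= 1 ->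
     0 <= r' <= 1 -> `|r - s| < e -> `|r' - s| < e -> P r -> P r') ->
  P 0 -> forall s, 0 <= s <= 1 -> P s.
Proof.
move=> Ploc P0 s hs.
pose good (p : R * R) := 0 < p.2 /\ forall r r', 0 <= r <= 1 -> 0 <= r' <= 1 ->
  `|r - p.1| < p.2 -> `|r' - p.1| < p.2 -> P r -> P r'.
(* For [Q] equal to [P] or its negation, an open set whose trace on the interval is [Q]. *)
pose near_ (Q : R -> Prop) := \bigcup_(p in [set p : R * R |
  [/\ 0 <= p.1 <= 1, Q p.1 & good p]]) [set r | `|r - p.1| < p.2].
have onear Q : open (near_ Q).
  apply: bigcup_open => p _; rewrite (_ : mkset _ = ball p.1 p.2).
    exact: ball_open.
  by apply/seteqP; split => r; rewrite /ball /= distrC.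
have nearE (Q : R -> Prop) r : 0 <= r <= 1 -> Q r -> near_ Q r.
  move=> hr Qr; have [e e0 He] := Ploc r hr.
  by exists (r, e) => //=; rewrite subrr normr0.
have := @segment_connected R 0 1 [set s | 0 <= s <= 1 /\ P s].
move=> /(_ _ _ _)/seteqP [|||_ /(_ s)].
- by exists 0; split=> //; rewrite lexx ler01.
- exists (near_ P) => //; apply/seteqP; split=> r /=; rewrite in_itv /=.
    by move=> [hr Pr]; split=> //; exact: nearE.
  move=> [hr [[p e] [/= hp Pp [e0 He]] rp]]; split=> //.
  by apply: He Pp => //; rewrite subrr normr0.
- exists (~` near_ (fun r => ~ P r)); first exact: open_closedC.
  apply/seteqP; split=> r /=; rewrite in_itv /= => -[hr Pr]; split=> //.
    move=> [[p e] [/= hp Pp [e0 He]] rp]; apply: Pp.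
    by apply: He Pr => //; rewrite subrr normr0.
  by apply: contrapT => nP; apply: Pr; exact: nearE.
- by rewrite /= in_itv /= => /(_ hs) [].
Qed.

(** Stated at a single point, since lifts are controlled only for parameters near [y0]. *)
Lemma paste_continuous (Y Z : topologicalType) (s : R) (f1 f2 : Y * R -> Z) (y :
  Y) (t : R) :
  continuous_at (y, t) f1 -> continuous_at (y, t) f2 ->
  (t = s -> f1 (y, t) = f2 (y, t)) ->
  continuous_at (y, t) (fun z => if z.2 <= s then f1 z else f2 z).
Proof.
move=> c1 c2 f12 U nU0.
suff : nbhs (y, t) ((fun z => if z.2 <= s then f1 z else f2 z) @^-1` U) by [].
move: nU0 => /=.
have csnd : continuous (fun z : Y * R => z.2) by move=> z; exact: cvg_snd.
have [ts|st|ts] := ltgtP t s => nU.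
- have n1 : nbhs (y, t) [set z : Y * R | z.2 < s].
    apply: open_nbhs_nbhs; split=> //; apply: lt_continuous_open => //.
    exact: cst_continuous.
  by apply: (@filterS _ (nbhs (y, t)) _ _ _ _ (filterI n1 (c1 _ nU))) =>
    z [/= /ltW zs Uz]; rewrite /= zs.
- have n1 : nbhs (y, t) [set z : Y * R | s < z.2].
    apply: open_nbhs_nbhs; split=> //; apply: lt_continuous_open => //.
    exact: cst_continuous.
  by apply: (@filterS _ (nbhs (y, t)) _ _ _ _ (filterI n1 (c2 _ nU))) =>
    z [/= zs Uz]; rewrite /= leNgt zs.
have nU2 : nbhs (f2 (y, t)) U by rewrite -f12.
have n12 : nbhs (y, t) (f1 @^-1` U `&` f2 @^-1` U).
  by apply: filterI; [exact: c1|exact: c2].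
by apply: filterS n12 => z [U1 U2]; rewrite /preimage /=; case: ifP.
Qed.

End Circle.

(** * Path lifting *)

Lemma pair_continuous_at (X Y Z : topologicalType) (f : X -> Y) (g : X -> Z) x :
  continuous_at x f -> continuous_at x g -> continuous_at x (fun x => (f x,
    g x)).
Proof. by move=> cf cg; exact: (cvg_pair cf cg). Qed.

Lemma fst_continuous (X Y : topologicalType) : continuous (fun z : X * Y =>
  z.1).
Proof. by move=> z; exact: cvg_fst. Qed.

Lemma snd_continuous (X Y : topologicalType) : continuous (fun z : X * Y =>
  z.2).
Proof. by move=> z; exact: cvg_snd. Qed.

Lemma pair_map_continuous (X Y Z : topologicalType) (g : Y -> Z) :
  continuous g -> continuous (fun z : X * Y => (z.1, g z.2)).
Proof.
move=> cg z; apply: pair_continuous_at; first exact: fst_continuous.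
by apply: (continuous_comp (f := fun z : X * Y => z.2));
  [exact: snd_continuous|exact: cg].
Qed.

Lemma comp_continuous (X Y Z : topologicalType) (f : X -> Y) (g : Y -> Z) :
  continuous f -> continuous g -> continuous (g \o f).
Proof. by move=> cf cg x; exact: (continuous_comp (cf x) (cg (f x))). Qed.

Lemma cst_continuous_at (X Y : topologicalType) (y : Y) (x : X) :
  continuous_at x (fun=> y).
Proof. exact: cvg_cst. Qed.

Lemma slice1_continuous_at (X Y Z : topologicalType) (f : X * Y -> Z) x y :
  {for (x, y), continuous f} -> {for x, continuous (fun x => f (x, y))}.
Proof.
move=> cf; apply: (continuous_comp (f := fun x => (x, y)) (g := f)) => //.
by apply: pair_continuous_at; [exact: cvg_id|exact: cst_continuous_at].
Qed.

Lemma slice2_continuous_at (X Y Z : topologicalType) (f : X * Y -> Z) x y :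
  {for (x, y), continuous f} -> {for y, continuous (fun y => f (x, y))}.
Proof.
move=> cf; apply: (continuous_comp (f := fun y => (x, y)) (g := f)) => //.
by apply: pair_continuous_at; [exact: cst_continuous_at|exact: cvg_id].
Qed.

Lemma locally_eq_continuous_at (X Y : topologicalType) (f g : X -> Y) (N :
  set X) x :
  nbhs x N -> N x -> (forall y, N y -> g y = f y) -> {for x, continuous f} ->
  {for x, continuous g}.
Proof.
move=> nN Nx gf cf U; rewrite gf // => /cf nU.
by apply: (filterS _ (filterI nN nU)) => y [Ny Uy]; rewrite /preimage /= gf.
Qed.

Section Lifting.
Variables (R : realType) (G : finGroupoid).
Local Notation BG := (classifying_space R G).
Local Notation E x := (wspace R (star x)).

Definition sheet (x : G) (c : R) (a : star x) : set BG :=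
  @wproj R G x @` levelset c a.

Lemma sheet_open (x : G) c (a : star x) : open (sheet c a).
Proof. by apply: wproj_open_map; exact: levelset_open. Qed.

(** Words with equal image differ by a translation; as it fixes the letter at level [c], it is the
    identity. *)
Lemma levelset_wproj_inj (x : G) c (a : star x) (e e' : E x) :
  levelset c a e -> levelset c a e' -> wproj e = wproj e' -> e = e'.
Proof.
move=> Ve Ve' /wproj_eq [h hE].
have Ve2 := levelset_wmap (translate h) Ve; rewrite -hE in Ve2.
have ha := levelset_uniq Ve' Ve2.
have h1 : h = idg x by apply: (@translate_inj _ _ _ _ _ a); rewrite translate1.
by rewrite hE h1 wmap_id // => f; exact: translate1.
Qed.

(** [wproj] is open, and injective on the level set, so its inverse there is continuous. Off the
    sheet, [s] takes the default value [e0]. *)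
Lemma wproj_section (x : G) c (a : star x) (e0 : E x) : levelset c a e0 ->
  exists s : BG -> E x, forall q, (sheet c a) q ->
    [/\ levelset c a (s q), wproj (s q) = q & {for q, continuous s}].
Proof.
move=> Ve0.
pose s (q : BG) : E x :=
  if pselect (exists e, levelset c a e /\ wproj e = q) is left H
  then projT1 (cid H) else e0.
have sP q : (sheet c a) q -> levelset c a (s q) /\ wproj (s q) = q.
  move=> [e Ve eq]; rewrite /s; case: pselect => [H|[]]; last by exists e.
  by case: (cid H).
exists s => q Aq; have [Vs sq] := sP q Aq; split=> // U.
rewrite nbhsE => -[W [oW Ws] WU].
have : nbhs q (@wproj R G x @` (W `&` levelset c a)).
  apply: open_nbhs_nbhs; split; last by exists (s q).
  by apply: wproj_open_map; apply: openI => //; exact: levelset_open.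
apply: filterS => _ [e [We Ve] <-]; apply: WU.
have Ae : (sheet c a) (wproj e) by exists e.
have [Vs' sq'] := sP _ Ae.
by rewrite (levelset_wproj_inj Vs' Ve sq').
Qed.

(** Agreement is locally constant: by injectivity on a level set where the lifts agree, by Hausdorff
    separation where they differ. *)
Lemma lift_unique (x : G) (f g : R -> E x) :
  continuous f -> continuous g -> (forall t, wproj (f t) = wproj (g t)) ->
  f 0 = g 0 -> forall t, 0 <= t <= 1 -> f t = g t.
Proof.
move=> cf cg fg fg0; apply: interval_induction => // s hs.
suff [N nN NP] : exists2 N, nbhs s N &
    forall r r', N r -> N r' -> f r = g r -> f r' = g r'.
  move: nN => /nbhs_ballP [e e0 eN]; exists e => // r r' _ _ rs rs'.
  by apply: NP; apply: eN; rewrite /ball /= distrC.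
have [fgs|fgs] := pselect (f s = g s).
  have [c [a Va]] := levelset_cover (f s).
  exists (f @^-1` levelset c a `&` g @^-1` levelset c a).
    apply: filterI; [apply: cf|apply: cg]; apply: open_nbhs_nbhs;
      by split; rewrite -?fgs //; exact: levelset_open.
  move=> r r' _ [Vf Vg] _; exact: levelset_wproj_inj Vf Vg (fg r').
have [U [V [nU nV UV]]] := hausdorff_sep (@wspace_hausdorff _ _) fgs.
exists (f @^-1` U `&` g @^-1` V); first by apply: filterI;
  [exact: cf|exact: cg].
move=> r r' [Ur Vr] _ fgr; suff : set0 (f r) by [].
by rewrite -UV; split=> //; rewrite fgr.
Qed.

Section Family.
Variables (Y : topologicalType) (F : Y * R -> BG).
Hypothesis cF : continuous F.
Variable y0 : Y.

(** The family is stopped at time [s] by [clamp], so a partial lift is still defined on all of [R];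
    the neighborhood [N] may depend on [s]. *)
Let lifts_upto (s : R) : Prop :=
  exists (x : G) (N : set Y) (f : Y * R -> E x), [/\ open N, N y0 &
    forall y t, N y -> {for (y, t), continuous f} /\
      wproj (f (y, t)) = F (y, clamp 0 s t)].

Let clampF_continuous (a b : R) : continuous (fun z : Y * R => F (z.1,
  clamp a b z.2)).
Proof.
move=> z; apply: (continuous_comp (f := fun z : Y * R => (z.1, clamp a b z.2)));
  last exact: cF.
apply: pair_continuous_at; first exact: cvg_fst.
apply: (continuous_comp (f := fun z : Y * R => z.2)); first exact: cvg_snd.
exact: clamp_continuous.
Qed.

Lemma lifts_upto0 : lifts_upto 0.
Proof.
have [x [e e0]] := wproj_surj (F (y0, 0)).
have [c [a Ve]] := levelset_cover e.
have [s sP] := wproj_section Ve.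
pose A := sheet c a.
have oA : open A by exact: sheet_open.
have c0 (t : R) : clamp 0 0 t = 0.
  by apply/le_anti; rewrite andbC; exact: clampP.
have cF0 : continuous (fun y => F (y, 0)).
  move=> y; apply: (continuous_comp (f := fun y => (y, 0 : R))); last exact: cF.
  by apply: pair_continuous_at; [exact: cvg_id|exact: cst_continuous_at].
exists x, ((fun y => F (y, 0)) @^-1` A), (fun z => s (F (z.1, clamp 0 0 z.2))).
split.
- by move/continuousP: cF0; apply.
- by rewrite /preimage /= e0; exists e.
move=> y t; rewrite /preimage /= -{1}(c0 t) => Ay; have [_ sF cs] := sP _ Ay.
split=> //.
apply: (continuous_comp (f := fun z : Y * R => F (z.1, clamp 0 0 z.2)) (g :=
  s)) => //.
exact: clampF_continuous.
Qed.

Lemma lifts_upto_extend (x0 : G) c (a : star x0) (e0 : E x0) (s s' : R) :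
  levelset c a e0 -> 0 <= s -> s <= s' ->
  (forall t, s <= t <= s' -> (sheet c a) (F (y0, t))) ->
  lifts_upto s -> lifts_upto s'.
Proof.
move=> Ve0 s0 ss' FA [x [N [f [oN Ny0 fP]]]].
have oA : open (sheet c a).
  exact: sheet_open.
have [||N1 [T [oN1 oT N1y0 sT N1T]]] := @tube _ _ [set y0] `[s, s']%classic
    (F @^-1` (sheet c a)) (@compact_set1 _ y0) (@segment_compact _ s s').
- by move/continuousP: cF; apply.
- by move=> [y t] [/= -> ]; rewrite in_itv; exact: FA.
have {}N1T y t : N1 y -> s <= t <= s' -> (sheet c a) (F (y, t)).
  by move=> N1y st; apply: (N1T (y, t)); split=> //; apply: sT;
    rewrite /= in_itv.
have cs (b : R) (b0 : s <= b) : clamp 0 b s = s by apply: clamp_id; rewrite s0.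
have fs y : N y -> wproj (f (y, s)) = F (y, s).
  by move=> Ny; have [_ ->] := fP y s Ny; rewrite cs.
(* The sheet comes from a word out of [x0], the lift from words out of [x]; [h] relabels the sheet
   so that it continues the lift. *)
have [h Vh] : exists h : hom x x0, levelset c (translate h a) (f (y0, s)).
  have [e1 Ve1 e1F] : (sheet c a) (F (y0, s)).
    by apply: FA; rewrite lexx.
  have [h hE] : exists h : hom x x0, f (y0, s) = wmap (translate h) e1.
    by apply: wproj_eq; rewrite e1F fs.
  by exists h; rewrite hE; exact: levelset_wmap.
have AE q : (sheet c a) q ->
    (sheet c (translate h a)) q.
  move=> [e Ve <-]; exists (wmap (translate h) e); first exact: levelset_wmap.
  exact: wproj_translate.
have [sec secP] := wproj_section Vh.
pose N2 : set Y := (N `&` N1 `&` [set y | levelset c (translate h a) (f (y,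
  s))])°.
have N2P y : N2 y -> [/\ N y, N1 y & levelset c (translate h a) (f (y, s))].
  by move=> /interior_subset [[]].
exists x, N2, (fun z => if z.2 <= s then f z else sec (F (z.1,
  clamp s s' z.2))).
split.
- exact: open_interior.
- apply: filterI; first by apply: filterI; apply: open_nbhs_nbhs; split=> //;
  exact: N1y0.
  have [cf _] := fP y0 s Ny0.
  have cy : continuous_at y0 (fun y => f (y, s)).
    apply: (continuous_comp (f := fun y => (y, s))) => //.
    by apply: pair_continuous_at; [exact: cvg_id|exact: cst_continuous_at].
  by apply: cy; apply: open_nbhs_nbhs; split=> //; exact: levelset_open.
move=> y t /N2P [Ny N1y Vy]; have [cf fE] := fP y t Ny.
have At : (sheet c (translate h a)) (F (y, clamp s s' t)).
  by apply/AE/N1T => //; exact: clampP.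
have [Vsec secE csec] := secP _ At.
split.
  apply: paste_continuous => //.
    apply: (continuous_comp (f := fun z : Y * R => F (z.1,
      clamp s s' z.2)) (g := sec)) => //.
    exact: clampF_continuous.
  move=> ts /=; subst t; have css : clamp s s' s = s by apply: clamp_id;
    rewrite lexx.
  move: Vsec secE; rewrite css => Vsec secE.
  by apply: levelset_wproj_inj Vy Vsec _; rewrite secE fs.
rewrite /=; have [ts|st] := leP t s.
  rewrite fE; congr (F (_, _)); rewrite /clamp.
  by rewrite (min_r ts) min_r // (le_trans ts).
rewrite secE; congr (F (_, _)); rewrite /clamp.
rewrite !max_r ?le_min ?s0 ?ss' ?(ltW st) ?(le_trans s0 ss')
  ?(le_trans s0 (ltW st)) //.
Qed.

Lemma lift_family : exists (x : G) (N : set Y) (f : Y * R -> E x),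
  [/\ open N, N y0 & forall y t, N y -> {for (y, t), continuous f} /\
      wproj (f (y, t)) = F (y, clamp 0 1 t)].
Proof.
apply: (@interval_induction R lifts_upto) lifts_upto0 1 _;
  last by rewrite ler01 lexx.
move=> s0 hs0.
have [x0 [e e0]] := wproj_surj (F (y0, s0)).
have [c [a Ve]] := levelset_cover e.
pose A := sheet c a.
have oA : open A by exact: sheet_open.
have cFy : continuous (fun t => F (y0, t)).
  move=> t; apply: (continuous_comp (f := fun t : R => (y0, t)));
    last exact: cF.
  by apply: pair_continuous_at; [exact: cst_continuous_at|exact: cvg_id].
have : nbhs s0 ((fun t => F (y0, t)) @^-1` A).
  by apply: cFy; apply: open_nbhs_nbhs; split=> //; rewrite e0; exists e.
move=> /nbhs_ballP [eps eps0 epsA];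
  exists eps => // r r' /andP[r0 r1] /andP[r'0 r'1] rs rs'.
have [rr'|r'r] := leP r r'.
  apply: (lifts_upto_extend Ve r0 rr') => t /andP[rt tr'].
  apply: epsA; rewrite /ball /=.
  move: rs rs'; rewrite !ltr_distl => /andP[? ?] /andP[? ?]; apply/andP; split;
    lra.
(* For [r' < r], the lift up to [r] is stopped at [r']. *)
move=> [x [N [f [oN Ny0 fP]]]].
exists x, N, (fun z => f (z.1, clamp 0 r' z.2)); split=> // y t Ny.
have [cf fE] := fP y (clamp 0 r' t) Ny; split.
  apply: (continuous_comp (f := fun z : Y * R => (z.1, clamp 0 r' z.2)) (g :=
    f)) => //.
  apply: pair_continuous_at; first exact: cvg_fst.
  apply: (continuous_comp (f := fun z : Y * R => z.2)); first exact: cvg_snd.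
  exact: clamp_continuous.
rewrite fE; congr (F (_, _)); apply: clamp_id.
have /andP[-> h] := clampP t r'0; exact: le_trans h (ltW r'r).
Qed.

End Family.
End Lifting.

(** * The homotopy inverse *)

Section Equivalence.
Variables (R : realType) (G : finGroupoid).
Local Notation L := (loop_groupoid G).
Local Notation BG := (classifying_space R G).
Local Notation BL := (classifying_space R L).
Local Notation LBG := (free_loop_space R BG).
Local Notation E x := (wspace R (star x)).
Local Notation I := (unit_interval R).

Lemma split_point_continuous (x : G) (c : hom x x) :
  continuous (fun z : E x * I => wproj (wsplit (translate c) z.1 z.2)).
Proof.
move=> z; apply: (continuous_comp (f := fun z : E x * I =>
  wsplit (translate c) z.1 z.2)).
  exact: wsplit_continuous.
exact: wproj_continuous.
Qed.

Lemma Par_continuous : continuous (@Par R G).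
Proof.
apply: loop_space_to_continuous => x c.
apply: (loop_continuous (@split_point_continuous x c)) => e u /=.
exact: Par_loop_proj.
Qed.

Lemma clampI_clamp (t : R) : clampI (clamp 0 1 t) = clampI t.
Proof.
apply: val_inj; change (clamp 0 1 (clamp 0 1 t) = clamp 0 1 t).
by apply: clamp_id; exact: clampP.
Qed.

Lemma clampI0 : clampI 0 = unit0 R.
Proof. by apply: val_inj; rewrite /= clamp_id // lexx ler01. Qed.

Lemma clampI1 : clampI 1 = unit1 R.
Proof. by apply: val_inj; rewrite /= clamp_id // lexx ler01. Qed.

(* For a lift [f] of a loop [l] with holonomy [c], the lifts [f u] and
   [wsplit (translate c) (f 0) u] are joined by a segment, running from the
   Parmesan loop at [s = 0] to [l] at [s = 1]. Both lifts are translated by [c]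
   between [u = 0] and [u = 1], so the segment closes up after projection. *)
Definition straight (x : G) (c : hom x x) (f : R -> E x) (s u : I) : BG :=
  wproj (wjoin (f (val u)) (wsplit (translate c) (f 0) u) s).

Lemma straight_continuous (Y : topologicalType) (x : G) (c : hom x x)
    (f : Y * R -> E x) (y : Y) (s u : I) : (forall t, {for (y, t),
      continuous f}) ->
  {for (y, s, u), continuous (fun z : Y * I * I =>
    straight c (fun t => f (z.1.1, t)) z.1.2 z.2)}.
Proof.
move=> cf.
pose g (z : Y * I * I) : E x * E x * I :=
  (f (z.1.1, val z.2), wsplit (translate c) (f (z.1.1, 0)) z.2, z.1.2).
have c11 : continuous (fun z : Y * I * I => z.1.1).
  by move=> z;
    exact: (continuous_comp (@fst_continuous _ _ z) (@fst_continuous Y I z.1)).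
have cval : continuous (val : I -> R) by exact: initial_continuous.
have cg : {for (y, s, u), continuous g}.
  apply: pair_continuous_at; first apply: pair_continuous_at.
  - apply: (continuous_comp (f := fun z : Y * I * I => (z.1.1, val z.2)) (g :=
    f)); last exact: cf.
    apply: pair_continuous_at; first exact: c11.
    exact: (continuous_comp (@snd_continuous _ _ _) (@cval _)).
  - apply: (continuous_comp (f := fun z : Y * I * I => (f (z.1.1, 0), z.2))
      (g := fun z : E x * I => wsplit (translate c) z.1 z.2));
        last exact: wsplit_continuous.
    apply: pair_continuous_at; last exact: snd_continuous.
    apply: (continuous_comp (f := fun z : Y * I * I => (z.1.1, 0 : R)) (g :=
      f)); last exact: cf.
    by apply: pair_continuous_at; [exact: c11|exact: cst_continuous_at].
  exact: (continuous_comp (@fst_continuous _ _ _) (@snd_continuous Y I _)).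
apply: (continuous_comp (f := g) (g := fun w : E x * E x * I =>
  wproj (wjoin w.1.1 w.1.2 w.2))) => //.
apply: (continuous_comp (f := fun w : E x * E x * I => wjoin w.1.1 w.1.2 w.2)).
  exact: wjoin_continuous.
exact: wproj_continuous.
Qed.

(* The space of loops is kept abstract: [Y] parametrizes a family of loops. *)
Section LoopFamily.
Variables (Y : topologicalType) (ev : Y * I -> BG).
Hypotheses (ev_continuous : continuous ev)
  (ev_ends : forall y, ev (y, unit0 R) = ev (y, unit1 R)).

Definition loop_path (l : Y) (t : R) : BG := ev (l, clampI t).

Definition holonomy (l : Y) (x : G) (c : hom x x) (f : R -> E x) : Prop :=
  [/\ continuous f, forall t, wproj (f t) = loop_path l t &
      f 1 = wmap (translate c) (f 0)].

Lemma loop_path_ends (l : Y) : loop_path l 1 = loop_path l 0.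
Proof. by rewrite /loop_path clampI0 clampI1. Qed.

(** The arrow relating the starting points relates the whole lifts. At time 1 the same word arises
    from [f 0] by [h \og c'] and by [c \og h], which are equal by freeness. *)
Lemma holonomy_unique l (x x' : G) (c : hom x x) (c' : hom x' x') f f' :
  holonomy l c f -> holonomy l c' f' -> exists h : hom x' x,
  c' = invg h \og c \og h /\
  forall t, 0 <= t <= 1 -> f' t = wmap (translate h) (f t).
Proof.
move=> [cf lf f1] [cf' lf' f1'].
have [h hE] := wproj_eq (etrans (lf 0) (esym (lf' 0))).
have H : forall t, 0 <= t <= 1 -> f' t = wmap (translate h) (f t).
  apply: lift_unique => // [t|t].
    by apply: continuous_comp; [exact: cf|exact: wmap_continuous].
  by rewrite wproj_translate lf lf'.
exists h; split=> //.
have := H 1; rewrite lexx ler01 => /(_ erefl).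
rewrite f1 f1' hE !wtranslateM => /wtranslate_inj E1.
by rewrite -compgA -E1 compgK.
Qed.

Lemma loop_path_continuous :
  continuous (fun z : Y * R => loop_path z.1 z.2).
Proof.
exact: (comp_continuous (pair_map_continuous (@clampI_continuous R))
  ev_continuous).
Qed.

Lemma loop_path_clamp l t : loop_path l (clamp 0 1 t) = loop_path l t.
Proof. by rewrite /loop_path clampI_clamp. Qed.

(** Holonomy is locally constant: near [l0] the endpoints keep the letters [a] and [translate c a]
    at level [d], which pins the terminal word within its fiber. *)
Lemma holonomy_family (l0 : Y) : exists (x : G) (c : hom x x) (N : set Y)
  (f : Y * R -> E x), [/\ open N, N l0,
    forall l t, N l -> {for (l, t), continuous f} &
    forall l, N l -> holonomy l c (fun t => f (l, t))].
Proof.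
have [x [N [f [oN Nl0 fP]]]] := lift_family loop_path_continuous l0.
have fE l t : N l -> wproj (f (l, t)) = loop_path l t.
  by move=> Nl; have [_ ->] := fP l t Nl; rewrite /= loop_path_clamp.
have ft l t : N l -> {for l, continuous (fun l => f (l, t))}.
  by move=> Nl; apply: slice1_continuous_at; have [] := fP l t Nl.
have [c cE] : exists c : hom x x, f (l0, 1) = wmap (translate c) (f (l0, 0)).
  by apply: wproj_eq; rewrite !fE // loop_path_ends.
have [d [a Va]] := levelset_cover (f (l0, 0)).
have Vc : levelset d (translate c a) (f (l0, 1)) by rewrite cE;
  exact: levelset_wmap.
pose N' : set Y := (N `&` [set l | levelset d a (f (l, 0))] `&`
  [set l | levelset d (translate c a) (f (l, 1))])°.
have N'P l : N' l -> [/\ N l, levelset d a (f (l, 0)) &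
    levelset d (translate c a) (f (l, 1))].
  by move=> /interior_subset [[]].
exists x, c, N', f; split.
- exact: open_interior.
- apply: filterI; first apply: filterI; first exact: open_nbhs_nbhs.
    by apply: (ft l0 0 Nl0); apply: open_nbhs_nbhs; split=> //;
      exact: levelset_open.
  by apply: (ft l0 1 Nl0); apply: open_nbhs_nbhs; split=> //;
    exact: levelset_open.
- by move=> l t /N'P [Nl _ _]; have [] := fP l t Nl.
move=> l /N'P [Nl V0 V1]; split.
- by move=> t; apply: slice2_continuous_at; have [] := fP l t Nl.
- by move=> t; exact: fE.
apply: (levelset_wproj_inj V1); first exact: levelset_wmap.
by rewrite wproj_translate !fE // loop_path_ends.
Qed.

Lemma holonomy_exists (l : Y) :
  exists d : {x : G & (hom x x * (R -> E x))%type},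
    holonomy l (tagged d).1 (tagged d).2.
Proof.
have [x [c [N [f [_ Nl _ H]]]]] := holonomy_family l.
by exists (Tagged (fun x : G => (hom x x * (R -> E x))%type) (c, fun t => f (l,
  t)));
   exact: H.
Qed.

Definition framing (l : Y) := projT1 (cid (holonomy_exists l)).

Lemma framingP l : holonomy l (tagged (framing l)).1 (tagged (framing l)).2.
Proof. exact: projT2 (cid (holonomy_exists l)). Qed.

Definition holonomy_point (l : Y) : BL :=
  loop_proj (tagged (framing l)).1 ((tagged (framing l)).2 0).

Lemma holonomy_pointE l (x : G) (c : hom x x) f : holonomy l c f ->
  holonomy_point l = loop_proj c (f 0).
Proof.
move=> /(holonomy_unique (framingP l)) [h [-> H]].
by rewrite H ?lexx ?ler01 // loop_proj_translate.
Qed.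

Lemma holonomy_point_continuous : continuous holonomy_point.
Proof.
move=> l0; have [x [c [N [f [oN Nl0 cf H]]]]] := holonomy_family l0.
apply: (locally_eq_continuous_at (f := fun l => loop_proj c (f (l, 0))) (N :=
  N)) => //.
- exact: open_nbhs_nbhs.
- by move=> l /H /holonomy_pointE.
apply: (continuous_comp (f := fun l : Y => f (l, 0)) (g := loop_proj c)).
  by apply: slice1_continuous_at; exact: cf.
exact: loop_proj_continuous.
Qed.

Lemma straight_unique l (x x' : G) (c : hom x x) (c' : hom x' x') f f' s u :
  holonomy l c f -> holonomy l c' f' -> straight c f s u = straight c' f' s u.
Proof.
move=> hf /(holonomy_unique hf) [h [-> H]].
rewrite /straight !H ?lexx ?ler01 //; last exact: unit_intervalP.
rewrite -(wmap_split (f := translate c));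
  first by rewrite -wmap_join wproj_translate.
by move=> a; rewrite !translateM !compgA compgV comp1g.
Qed.

Definition contraction (z : Y * I) (u : I) : BG :=
  straight (tagged (framing z.1)).1 (tagged (framing z.1)).2 z.2 u.

Lemma contractionE l (x : G) (c : hom x x) f s u : holonomy l c f ->
  contraction (l, s) u = straight c f s u.
Proof. by move=> H; apply: straight_unique H; exact: framingP. Qed.

(** The framings are chosen loop by loop without continuity; near each loop [contractionE] replaces
    them by one continuous family. *)
Lemma contraction_continuous :
  continuous (fun z : Y * I * I => contraction z.1 z.2).
Proof.
move=> [[l0 s0] u0]; have [x [c [N [f [oN Nl0 cf H]]]]] := holonomy_family l0.
apply: (locally_eq_continuous_at (N := [set z : Y * I * I | N z.1.1])
  _ _ _ (@straight_continuous Y x c f l0 s0 u0 _)) => //.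
- have nN : nbhs l0 N by exact: open_nbhs_nbhs.
  by exists ([set z : Y * I | N z.1], setT) => [|[z u] []] //=; split=> //;
     [exists (N, setT) => [|[l s] []] //; split=> //|]; exact: filterT.
- by move=> [[l s] u] /= /H Hl; exact: contractionE.
by move=> t; exact: cf.
Qed.

Lemma contraction_ends z : contraction z (unit0 R) = contraction z (unit1 R).
Proof.
rewrite /contraction /straight wsplit0 wsplit1.
have [_ _ /= ->] := framingP z.1.
by rewrite -wmap_join wproj_translate.
Qed.

Lemma contraction_fiber_continuous z : continuous (contraction z).
Proof.
move=> u.
exact: (slice2_continuous_at (@contraction_continuous (z, u))).
Qed.

End LoopFamily.

Lemma loop_eval_ends (l : LBG) : loop_eval (l, unit0 R) = loop_eval (l,
  unit1 R).
Proof.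
rewrite /loop_eval /=; congr (l _); apply/circle_piE; right.
by rewrite /is_end !eqxx orbT.
Qed.

Definition Par_inverse : LBG -> BL :=
  holonomy_point (@loop_eval_continuous R BG) loop_eval_ends.

Lemma Par_inverse_continuous : continuous Par_inverse.
Proof. exact: holonomy_point_continuous. Qed.

Lemma Par_inverseK (p : BL) : Par_inverse (Par p) = p.
Proof.
have [x [c [e ->]]] := loop_proj_surj p.
pose f t := wsplit (translate c) e (clampI t).
have f0 : f 0 = e by rewrite /f clampI0 wsplit0.
have cf : continuous f.
  have c2 := comp_continuous (@pair_map_continuous (E x)
    R I _ (@clampI_continuous R))
    (@wsplit_continuous R (star x) (translate c)).
  by move=> t; apply: (slice2_continuous_at
    (f := fun z : E x * R => wsplit (translate c) z.1 (clampI z.2))); exact: c2.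
have hf : holonomy (@loop_eval R BG) (Par (loop_proj c e)) c f.
  split=> // [t|]; first by rewrite /loop_path /loop_eval Par_loop_proj.
  by rewrite f0 /f clampI1 wsplit1.
by rewrite /Par_inverse (holonomy_pointE _ _ hf) f0.
Qed.

Let contract (z : LBG * I) : I -> BG :=
  contraction (@loop_eval_continuous R BG) loop_eval_ends z.

Lemma Par_inverse_homotopic : homotopic R (@Par R G \o Par_inverse) id.
Proof.
have cc z : continuous (contract z) by exact: contraction_fiber_continuous.
have ce z : contract z (unit0 R) = contract z (unit1 R) by exact:
  contraction_ends.
exists (fun z => make_loop (cc z) (ce z)); split.
- apply: (@loop_continuous R (LBG * I)%type BG (fun z => contract z.1 z.2)).
    exact: contraction_continuous.
  by move=> z u; exact: make_loopE.
- move=> l; apply: loop_ext => u;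
  rewrite make_loopE /= /Par_inverse /holonomy_point.
  by rewrite Par_loop_proj /contract /contraction /straight wjoin0.
move=> l; apply: loop_ext => u;
  rewrite make_loopE /contract /contraction /straight wjoin1.
have [_ -> _] := framingP (@loop_eval_continuous R BG) loop_eval_ends l.
by rewrite /loop_path clampI_val.
Qed.

End Equivalence.

Theorem theorem2 (R : realType) (G : finGroupoid) :
  homotopy_equivalence R (@Par R G).
Proof.
split; first exact: Par_continuous.
exists (@Par_inverse R G); split.
- exact: Par_inverse_continuous.
(* [Par_inverse] is a strict left inverse, so the constant homotopy suffices. *)
- exists fst; split=> [|p|//]; first exact: fst_continuous.
  by rewrite /= Par_inverseK.
exact: Par_inverse_homotopic.
Qed.
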